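(* Let $(\Omega,\mathcal{F},\mathbb{P})$ be a probability space and let $\mathcal{C}\subset \mathbb{L}^0_+$ be convex, max-closed and bounded, and such that $\mathcal{C}\cap \mathbb{L}^0_{++}\neq\emptyset$. Then the set $\mathcal{C}^{\mathsf{num}}$ of all numéraires of $\mathcal{C}$ is dense (for the topology of convergence in probability) in the set $\mathcal{C}^{\mathsf{max}}$ of all maximal elements of $\mathcal{C}$.
   Context: $\mathbb{L}^0$ is the set of all ($\mathbb{P}$-a.s. equivalence classes of) real-valued random variables on $(\Omega,\mathcal{F},\mathbb{P})$, with the topology induced by the metric $(f,g)\mapsto \mathbb{E}_{\mathbb{P}}[1\wedge|f-g|]$, i.e. convergence in probability. All relations between random variables are understood $\mathbb{P}$-a.s. $\mathbb{L}^0_+=\{f\in\mathbb{L}^0 : f\ge 0\}$ and $\mathbb{L}^0_{++}=\{f\in\mathbb{L}^0_+ : f>0\}$. For $\mathcal{C}\subseteq\mathbb{L}^0_+$, $\overline{\mathcal{C}}$ is its closure; $\mathcal{C}$ is bounded if $\lim_{\ell\to\infty}\sup_{f\in\mathcal{C}}\mathbb{P}[f>\ell]=0$. An element $f\in\mathcal{C}$ is maximal in $\mathcal{C}$ if $f\le g$ and $g\in\mathcal{C}$ imply $f=g$; $\mathcal{C}^{\mathsf{max}}$ is the set of all maximal elements of $\mathcal{C}$. $\mathcal{C}$ is max-closed if every maximal element of $\overline{\mathcal{C}}$ belongs to $\mathcal{C}$, i.e. $\overline{\mathcal{C}}^{\mathsf{max}}\subseteq\mathcal{C}$. For $\mathcal{C}$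 with $\mathcal{C}\cap\mathbb{L}^0_{++}\ne\emptyset$, an element $g\in\mathcal{C}$ is a numéraire of $\mathcal{C}$ if $g\in\mathbb{L}^0_{++}$ and there exists a probability measure $\mathbb{Q}$ equivalent to $\mathbb{P}$ such that $\mathbb{E}_{\mathbb{Q}}[f/g]\le 1$ for all $f\in\mathcal{C}$; $\mathcal{C}^{\mathsf{num}}$ is the set of all numéraires of $\mathcal{C}$. (Every numéraire of $\mathcal{C}$ is a maximal element of $\mathcal{C}$.) *)

(* Defs.v *)
From HB Require Import structures.
From mathcomp Require Import all_boot all_order all_algebra.
From mathcomp Require Import all_classical all_reals all_analysis.
From mathcomp Require Import measurable_realfun.

Set Implicit Arguments.
Unset Strict Implicit.
Unset Printing Implicit Defensive.

Import Order.TTheory GRing.Theory Num.Theory.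
Import numFieldNormedType.Exports.

Local Open Scope classical_set_scope.
Local Open Scope ring_scope.

(* Real random variables modulo P-a.s. equality: Leibniz equality in [L0 P] is
   a.s. equality, and [f : L0 P] is applied to a point through the
   representative [repr f]. *)
Definition L0 d (T : measurableType d) (R : realType) (P : probability T R)
  : Type := {mfun_ P, T >-> R}.

Section L0_structure.
Context d (T : measurableType d) (R : realType) (P : probability T R).
Local Open Scope quotient_scope.
Local Notation L0 := (L0 P).
Implicit Types f g h : L0.

HB.instance Definition _ := Choice.on L0.
HB.instance Definition _ := EqQuotient.on L0.

Definition L0_fun f : T -> R := repr f.
Coercion L0_fun : L0 >-> Funclass.

Lemma L0_measurable f : measurable_fun setT f.
Proof. exact: measurable_funPT. Qed.

Lemma L0_eqP f g : (\forall w \ae P, f w = g w) <-> f = g.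
Proof.
split=> [fg|->]; last exact: aeW.
rewrite -[f]reprK -[g]reprK; apply/eqP; rewrite eqmodE; apply/asboolP.
by apply: filterS fg => w + _.
Qed.

Definition L0_of (u : {mfun T >-> R}) : L0 := \pi_(L0) u.

Lemma L0_ofE u : \forall w \ae P, L0_of u w = u w.
Proof.
have : repr (\pi_(L0) u) == u %[mod L0] by rewrite reprK.
rewrite eqmodE => /asboolP; apply: filterS => w; exact.
Qed.

Definition L0_zero : L0 := L0_of 0.
Definition L0_opp f : L0 := L0_of (- repr f).
Definition L0_add f g : L0 := L0_of (repr f + repr g).
Definition L0_scale (a : R) f : L0 := L0_of (a *: repr f).

Lemma L0_zeroE : \forall w \ae P, L0_zero w = 0.
Proof. exact: L0_ofE. Qed.

Lemma L0_oppE f : \forall w \ae P, L0_opp f w = - f w.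
Proof. exact: L0_ofE. Qed.

Lemma L0_addE f g : \forall w \ae P, L0_add f g w = f w + g w.
Proof. exact: L0_ofE. Qed.

Lemma L0_scaleE a f : \forall w \ae P, L0_scale a f w = a * f w.
Proof. exact: L0_ofE. Qed.

Fact L0_addrA : associative L0_add.
Proof.
move=> f g h; apply/L0_eqP; near=> w.
rewrite (near (L0_addE f (L0_add g h)) w)// (near (L0_addE g h) w)//.
rewrite (near (L0_addE (L0_add f g) h) w)// (near (L0_addE f g) w)//.
by rewrite addrA.
Unshelve. all: by end_near. Qed.

Fact L0_addrC : commutative L0_add.
Proof. by move=> f g; rewrite /L0_add addrC. Qed.

Fact L0_add0r : left_id L0_zero L0_add.
Proof.
move=> f; apply/L0_eqP; near=> w.
by rewrite (near (L0_addE L0_zero f) w)// (near L0_zeroE w)// add0r.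
Unshelve. all: by end_near. Qed.

Fact L0_addNr : left_inverse L0_zero L0_opp L0_add.
Proof.
move=> f; apply/L0_eqP; near=> w.
rewrite (near (L0_addE (L0_opp f) f) w)// (near (L0_oppE f) w)//.
by rewrite (near L0_zeroE w)// addNr.
Unshelve. all: by end_near. Qed.

HB.instance Definition _ :=
  GRing.isZmodule.Build L0 L0_addrA L0_addrC L0_add0r L0_addNr.

Fact L0_scalerA a b f : L0_scale a (L0_scale b f) = L0_scale (a * b) f.
Proof.
apply/L0_eqP; near=> w.
rewrite (near (L0_scaleE a (L0_scale b f)) w)// (near (L0_scaleE b f) w)//.
by rewrite (near (L0_scaleE (a * b) f) w)// mulrA.
Unshelve. all: by end_near. Qed.

Fact L0_scale1r : left_id 1 L0_scale.
Proof.
move=> f; apply/L0_eqP; near=> w.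
by rewrite (near (L0_scaleE 1 f) w)// mul1r.
Unshelve. all: by end_near. Qed.

Fact L0_scalerDr : right_distributive L0_scale +%R.
Proof.
move=> a f g; apply/L0_eqP; near=> w.
rewrite (near (L0_scaleE a (L0_add f g)) w)// (near (L0_addE f g) w)//.
rewrite (near (L0_addE (L0_scale a f) (L0_scale a g)) w)//.
by rewrite (near (L0_scaleE a f) w)// (near (L0_scaleE a g) w)// mulrDr.
Unshelve. all: by end_near. Qed.

Fact L0_scalerDl f : {morph L0_scale^~ f : a b / a + b}.
Proof.
move=> a b; apply/L0_eqP; near=> w.
rewrite (near (L0_scaleE (a + b) f) w)//.
rewrite (near (L0_addE (L0_scale a f) (L0_scale b f)) w)//.
by rewrite (near (L0_scaleE a f) w)// (near (L0_scaleE b f) w)// mulrDl.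
Unshelve. all: by end_near. Qed.

HB.instance Definition _ := GRing.Zmodule_isLmodule.Build R L0
  L0_scalerA L0_scale1r L0_scalerDr L0_scalerDl.

Definition L0_dist f g : R := fine 'E_P[fun w => Num.min 1 `|f w - g w|].

Let trunc f g w : R := Num.min 1 `|f w - g w|.

Let trunc_ge0 f g w : 0 <= trunc f g w.
Proof. by rewrite /trunc le_min ler01 normr_ge0. Qed.

Let measurable_trunc f g : measurable_fun setT (trunc f g).
Proof.
apply: measurable_minr => //; apply: measurableT_comp => //.
by apply: measurable_funB; exact: L0_measurable.
Qed.

Let integrable_trunc f g : P.-integrable setT (EFin \o trunc f g).
Proof.
apply: (@le_integrable _ _ _ P setT measurableT _ (EFin \o cst 1)).
- by apply/measurable_EFinP; exact: measurable_trunc.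
- move=> w _ /=; rewrite lee_fin normr1 ger0_norm ?trunc_ge0//.
  by rewrite /trunc ge_min lexx.
- exact: finite_measure_integrable_cst.
Qed.

Let L0_distE f g : (L0_dist f g)%:E = (\int[P]_w (trunc f g w)%:E)%E.
Proof.
by rewrite /L0_dist unlock fineK//; exact/integrable_fin_num/integrable_trunc.
Qed.

Fact L0_distxx f : L0_dist f f = 0.
Proof.
apply: EFin_inj; rewrite L0_distE; apply: integral0_eq => w _.
by rewrite /trunc subrr normr0 min_r.
Qed.

Fact L0_dist_positivity f g : L0_dist f g = 0 -> f = g.
Proof.
move=> fg0; apply/L0_eqP.
have mfg : measurable_fun setT (EFin \o trunc f g).
  by apply/measurable_EFinP; exact: measurable_trunc.
have : (\int[P]_w `|(trunc f g w)%:E| = 0)%E.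
  by under eq_integral do rewrite /= ger0_norm//; rewrite -L0_distE fg0.
move/(ae_eq_integral_abs P measurableT mfg).
apply: filterS => w /(_ Logic.I) [].
rewrite /trunc; case: ltP => [_ /eqP|_ /eqP]; first by rewrite oner_eq0.
by rewrite normr_eq0 subr_eq0 => /eqP.
Qed.

Fact L0_dist_sym f g : L0_dist f g = L0_dist g f.
Proof. by rewrite /L0_dist; under eq_fun do rewrite distrC. Qed.

Fact L0_dist_triangle g f h : L0_dist f h <= L0_dist f g + L0_dist g h.
Proof.
have mE u v : measurable_fun setT (EFin \o trunc u v).
  by apply/measurable_EFinP; exact: measurable_trunc.
rewrite -lee_fin EFinD !L0_distE -ge0_integralD//;
  [|by move=> w _; rewrite lee_fin|exact: mE|
   by move=> w _; rewrite lee_fin|exact: mE].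
apply: ge0_le_integral => //; first by move=> w _; rewrite lee_fin.
- exact: mE.
- by apply: emeasurable_funD; exact: mE.
move=> w _; rewrite -EFinD lee_fin /trunc.
have := ler_distD (g w) (f w) (h w).
have := normr_ge0 (f w - g w); have := normr_ge0 (g w - h w).
move: `|f w - g w| `|g w - h w| `|f w - h w| => a b c b0 a0 cab.
case: (ltP 1 a) => a1; case: (ltP 1 b) => b1; rewrite ge_min.
- by rewrite lerDl ler01.
- by rewrite lerDl b0.
- by rewrite lerDr a0.
- by rewrite cab orbT.
Qed.

HB.instance Definition _ := @isMetric.Build R L0 L0_dist
  L0_distxx L0_dist_positivity L0_dist_sym L0_dist_triangle.

End L0_structure.

Section numeraires.
Context d (T : measurableType d) (R : realType) (P : probability T R).
Implicit Types (f g : L0 P) (C : set (L0 P)).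

Definition L0_le f g := \forall w \ae P, f w <= g w.

Definition L0_nneg : set (L0 P) := [set f | \forall w \ae P, 0 <= f w].

Definition L0_pos : set (L0 P) := [set f | \forall w \ae P, 0 < f w].

(* Meant for subsets of [L0_nneg]: there is no absolute value around [f w]. *)
Definition L0_bounded C :=
  ereal_sup [set P [set w | l < f w] | f in C] @[l --> +oo] --> 0%E.

Definition maximal C : set (L0 P) :=
  [set f | C f /\ forall g, C g -> L0_le f g -> f = g].

Definition max_closed C := maximal (closure C) `<=` C.

(* The value of [f w / g w] where [g w = 0] is irrelevant, as this is a
   Q-null event. *)
Definition numeraire C : set (L0 P) :=
  [set g | [/\ C g, L0_pos g & exists Q : probability T R,
     [/\ Q `<< P, P `<< Q &
         forall f, C f -> ('E_Q[fun w => (f w / g w)%R] <= 1)%E]]].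

End numeraires.
Arguments L0_nneg {d T R} P.
Arguments L0_pos {d T R} P.

Definition dense_in (X : topologicalType) (A B : set X) :=
  A `<=` B /\ B `<=` closure A.

(* Main.v *)
(* For a strictly positive [a] in the closure [K] of [C] and [k >= 1], let [g]
   minimize E[(a / h)^k] over the strictly positive [h] in [K]. The first-order
   condition reads E_Q[h / g] <= 1 for all [h] in [K], with dQ/dP proportional
   to (a / g)^k; thus [g] is a numeraire of [K], hence maximal in [K], hence in
   [C]. Given a maximal [f], take a = (1 - 1/k) f + p / k with [p] a strictly
   positive element of [C]: as E[(a / g)^k] <= 1, for large [k] the minimizer
   cannot be noticeably smaller than [f], and maximality of [f] then forces it
   to be close to [f].
   Minimizers exist because for the bounded strictly convex functional
   E[1 / (1 + h)] the midpoint gain controls E[(1/(1+f) - 1/(1+h))^2], so that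
   near-minimizers on a decreasing sequence of convex sets are Cauchy;
   boundedness in probability keeps the limit finite. *)
Require Import Defs.
From HB Require Import structures.
From mathcomp Require Import all_boot all_order all_algebra.
From mathcomp Require Import all_classical all_reals all_analysis.
From mathcomp Require Import measurable_realfun lra ring zify.

Set Implicit Arguments.
Unset Strict Implicit.
Unset Printing Implicit Defensive.

Import Order.TTheory GRing.Theory Num.Theory.
Import numFieldNormedType.Exports.

Local Open Scope classical_set_scope.
Local Open Scope ring_scope.

(** * Expectations of nonnegative random variables *)

Section measurability.
Context d (T : measurableType d) (R : realType).

(** Working in the closure [K] is forced: [C] is only max-closed, so limits of its elements are
    available in [K] alone and return to [C] through maximality; this requires maximal elements of
    [C] to stay maximal in [K]. The large exponent replaces a pointwise bound: E[(a / g)^k] <= 1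
    bounds an L^k norm, which for large k nearly says a <= g. Mixing in [p] serves the set where [f]
    vanishes: without it [a] and the density (a / g)^k would vanish there, and Q would not be
    equivalent to P. As h / g is not known to be integrable beforehand, the derivative at g is not
    taken under the integral; an inequality for finite steps t, followed by Fatou's lemma, replaces
    it. One extraction principle, based on the penalty, supplies convergent sequences three times:
    for the minimizer of the power functional, for a maximal element above a given one, and for the
    stability of a maximal element. *)

Lemma measurable_funV (f : T -> R) :
  measurable_fun setT f -> measurable_fun setT (fun w => (f w)^-1).
Proof.
move=> mf.
(* [powR] yields the inverse for nonnegative bases, hence the square; the factor [f w] restores the
   sign and the value 0 where [f w = 0]. *)
have -> : (fun w => (f w)^-1) = (fun w => f w * ((f w * f w) `^ (-1))).
  apply/funext => w; rewrite powR_inv1 -?expr2 ?sqr_ge0//.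
  have [->|fw0] := eqVneq (f w) 0; first by rewrite invr0 mul0r.
  by rewrite expr2 invfM mulrA divff// mul1r.
apply: measurable_funM => //.
apply: (@measurableT_comp _ _ _ _ _ _ (@powR R ^~ (-1)) _
  (fun w => f w * f w)); first exact: measurable_powR.
exact: measurable_funM.
Qed.

End measurability.

Ltac meas := solve [ by [] | exact: L0_measurable
    | match goal with mf : forall _, measurable_fun _ _ |- _ => exact: mf end
    | apply: measurable_funD; meas | apply: measurable_funB; meas
    | apply: measurable_funM; meas | apply: measurable_funV; meas
    | apply: measurable_funX; meas
    | apply: measurable_minr; meas | apply: measurable_maxr; meas
    | apply: measurableT_comp; [by []|]; meas ].

Section mean.
Context d (T : measurableType d) (R : realType) (P : probability T R).
Implicit Types u v : T -> R.
Local Open Scope ereal_scope.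

Definition mean u := \int[P]_w (u w)%:E.

Lemma mean_ge0 u : (forall w, 0 <= u w)%R -> 0 <= mean u.
Proof. by move=> u0; apply: integral_ge0 => w _; rewrite lee_fin. Qed.

Lemma ae_le_mean u v : measurable_fun setT u -> measurable_fun setT v ->
  (forall w, 0 <= u w)%R -> (forall w, 0 <= v w)%R ->
  (\forall w \ae P, u w <= v w)%R -> mean u <= mean v.
Proof.
move=> mu mv u0 v0 uv; apply: ae_ge0_le_integral => //.
- by move=> w _; rewrite lee_fin.
- exact/measurable_EFinP.
- by move=> w _; rewrite lee_fin.
- exact/measurable_EFinP.
- by apply: filterS uv => w uv _; rewrite lee_fin.
Qed.

Lemma mean_cst (c : R) : mean (fun=> c) = c%:E.
Proof.
by rewrite /mean (integral_cst P measurableT) [X in _ * X](probability_setT P) mule1.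
Qed.

Lemma meanD u v : measurable_fun setT u -> measurable_fun setT v ->
  (forall w, 0 <= u w)%R -> (forall w, 0 <= v w)%R ->
  mean (fun w => u w + v w)%R = mean u + mean v.
Proof.
move=> mu mv u0 v0; rewrite /mean -ge0_integralD//.
- by move=> w _; rewrite lee_fin.
- exact/measurable_EFinP.
- by move=> w _; rewrite lee_fin.
- exact/measurable_EFinP.
Qed.

Lemma meanZ (c : R) u : measurable_fun setT u -> (forall w, 0 <= u w)%R ->
  (0 <= c)%R -> mean (fun w => c * u w)%R = c%:E * mean u.
Proof.
move=> mu u0 c0; rewrite /mean -ge0_integralZl_EFin//.
- by move=> w _; rewrite lee_fin.
- exact/measurable_EFinP.
Qed.

Lemma mean_le_cst u (c : R) : measurable_fun setT u -> (forall w, 0 <= u w <= c)%R ->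
  mean u <= c%:E.
Proof.
move=> mu uc; rewrite -mean_cst; apply: ae_le_mean => //.
- by move=> w; case/andP: (uc w).
- by move=> w; case/andP: (uc w) => /le_trans; apply.
- by apply: aeW => w; case/andP: (uc w).
Qed.

Lemma fin_num_mean u (c : R) : measurable_fun setT u -> (forall w, 0 <= u w)%R ->
  mean u <= c%:E -> mean u \is a fin_num.
Proof.
move=> mu u0 uc; rewrite ge0_fin_numE ?mean_ge0//.
exact: le_lt_trans uc (ltry _).
Qed.

Lemma mean_indic (A : set T) : measurable A -> mean (\1_A) = P A.
Proof. by move=> mA; rewrite /mean integral_indic// setIT. Qed.

Lemma mean_eq0 u : measurable_fun setT u -> (forall w, 0 <= u w)%R ->
  mean u <= 0 -> \forall w \ae P, u w = 0%R.
Proof.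
move=> mu u0 uc.
have : \int[P]_w `|(u w)%:E| = 0.
  under eq_integral do rewrite gee0_abs ?lee_fin//.
  by apply/eqP; rewrite eq_le uc mean_ge0.
move/(ae_eq_integral_abs P measurableT); case/(_ _)/wrap.
  exact/measurable_EFinP.
by move=> h; apply: filterS h => w /(_ Logic.I) [].
Qed.

Lemma mean_le_ae_eq u v : measurable_fun setT u -> measurable_fun setT v ->
  (forall w, 0 <= u w)%R -> (forall w, 0 <= v w)%R ->
  (\forall w \ae P, u w <= v w)%R -> mean v <= mean u -> mean u < +oo ->
  \forall w \ae P, u w = v w.
Proof.
move=> mu mv u0 v0 uv vu ufin.
pose z w := Num.max 0%R (v w - u w)%R.
have mz : measurable_fun setT z by rewrite /z; meas.
have z0 w : (0 <= z w)%R by rewrite /z le_max lexx.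
have : mean z <= 0.
  have : mean u + mean z <= mean u.
    rewrite -meanD//; apply: le_trans vu.
    apply: ae_le_mean => //; first by meas.
      by move=> w; rewrite addr_ge0.
    by apply: filterS uv => w uvw; rewrite /z max_r ?subr_ge0// subrKC.
  have ufin' : mean u \is a fin_num by rewrite ge0_fin_numE// mean_ge0.
  by rewrite -leeBrDl// subee.
move/(mean_eq0 mz z0) => z00.
apply: filterS2 uv z00 => w uvw; rewrite /z max_r ?subr_ge0// => /eqP.
by rewrite subr_eq0 => /eqP.
Qed.

Lemma fatou_mean (u_ : nat -> T -> R) (c : \bar R) :
  (forall n, measurable_fun setT (u_ n)) -> (forall n w, 0 <= u_ n w)%R ->
  (\forall n \near \oo, mean (u_ n) <= c) ->
  \int[P]_w (limn_einf (fun n => (u_ n w)%:E)) <= c.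
Proof.
move=> mu u0 uc.
apply: (@le_trans _ _ (limn_einf (fun n => mean (u_ n)))).
  apply: fatou => //.
    by move=> n; apply/measurable_EFinP.
  by move=> n w _; rewrite lee_fin.
rewrite limn_einf_lim; apply: lime_le; first exact: is_cvg_einfs.
case: uc => N _ uc; exists N => // n /= Nn.
apply: le_trans (uc n Nn); apply: ereal_inf_lbound.
by exists n => /=.
Qed.

Let limn_einf_ge0 (u_ : nat -> R) : (forall n, 0 <= u_ n)%R ->
  0 <= limn_einf (fun n => (u_ n)%:E).
Proof.
move=> u0; rewrite limn_einf_lim; apply: lime_ge; first exact: is_cvg_einfs.
apply: nearW => n; apply: le_ereal_inf_tmp => _ [m _ <-].
by rewrite lee_fin.
Qed.

Let measurable_limn_einf (u_ : nat -> T -> R) :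
  (forall n, measurable_fun setT (u_ n)) ->
  measurable_fun setT (fun w => limn_einf (fun n => (u_ n w)%:E)).
Proof.
move=> mu; rewrite /limn_einf; apply: measurableT_comp => //.
apply: measurable_fun_limn_esup => n.
by apply: measurableT_comp => //; exact/measurable_EFinP.
Qed.

Lemma mean_fatou (u_ : nat -> T -> R) u (c : \bar R) :
  (forall n, measurable_fun setT (u_ n)) -> (forall n w, 0 <= u_ n w)%R ->
  measurable_fun setT u -> (forall w, 0 <= u w)%R ->
  (\forall w \ae P, u_ ^~ w @ \oo --> u w) ->
  (\forall n \near \oo, mean (u_ n) <= c) -> mean u <= c.
Proof.
move=> mu u0 mv v0 uv uc; apply: le_trans (fatou_mean mu u0 uc).
apply: ae_ge0_le_integral => //.
- by move=> w _; rewrite lee_fin.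
- exact/measurable_EFinP.
- by move=> w _; exact: limn_einf_ge0.
- exact: measurable_limn_einf.
apply: filterS uv => w uw _.
have /cvg_limn_einf_sup[-> _]// : (fun n => (u_ n w)%:E) @ \oo --> (u w)%:E.
by apply: cvg_EFin => //; exact: nearW.
Qed.

(** By Fatou's lemma the lower limit is integrable, hence finite almost everywhere. *)
Lemma mean_not_pinfty (u_ : nat -> T -> R) (c : R) :
  (forall n, measurable_fun setT (u_ n)) -> (forall n w, 0 <= u_ n w)%R ->
  (\forall n \near \oo, mean (u_ n) <= c%:E) ->
  \forall w \ae P, ~ (u_ ^~ w @ \oo --> +oo%R).
Proof.
move=> mu u0 uc.
have intf : P.-integrable setT (fun w => limn_einf (fun n => (u_ n w)%:E)).
  apply/integrableP; split; first exact: measurable_limn_einf.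
  under eq_integral do rewrite gee0_abs ?limn_einf_ge0//.
  by apply: le_lt_trans (fatou_mean mu u0 uc) _; rewrite ltry.
apply: filterS (integrable_ae measurableT intf) => w /(_ Logic.I) + uw.
have /cvg_limn_einf_sup[-> _]// : (fun n => (u_ n w)%:E) @ \oo --> +oo.
exact/cvgeryP.
Qed.

Lemma mean_cvg (u_ : nat -> T -> R) u :
  (forall n, measurable_fun setT (u_ n)) -> (forall n w, 0 <= u_ n w <= 1)%R ->
  measurable_fun setT u ->
  (\forall w \ae P, u_ ^~ w @ \oo --> u w) ->
  mean (u_ n) @[n --> \oo] --> mean u.
Proof.
move=> mu u0 mv uv.
have [] // := @dominated_convergence _ _ _ P setT measurableT
   (fun n w => (u_ n w)%:E) (EFin \o u) (EFin \o cst 1%R).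
- by move=> n; apply/measurable_EFinP.
- exact/measurable_EFinP.
- by apply: filterS uv => w uw _; apply: cvg_EFin => //; exact: nearW.
- exact: finite_measure_integrable_cst.
- apply: aeW => w n _; rewrite /= lee_fin.
  by case/andP: (u0 n w) => ? ?; rewrite ger0_norm.
Qed.

(** The partial sums are nondecreasing with means at most [c * 2], so almost nowhere can they tend
    to infinity. *)
Lemma mean_summable (v_ : nat -> T -> R) (c : R) :
  (forall n, measurable_fun setT (v_ n)) -> (forall n w, 0 <= v_ n w)%R ->
  (forall n, mean (v_ n) <= (c * (2^-1) ^+ n)%:E) ->
  \forall w \ae P, cvgn (series (v_ ^~ w)).
Proof.
move=> mv v0 vc.
pose S n w := series (v_ ^~ w) n.
have S0 n w : (0 <= S n w)%R by apply: sumr_ge0.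
have SS n : S n.+1 = (fun w => S n w + v_ n w)%R.
  by apply/funext => w; rewrite /S /series /= big_nat_recr.
have mS n : measurable_fun setT (S n).
  elim: n => [|n ih]; last by rewrite SS; meas.
  rewrite (_ : S 0%N = fun=> 0%R); first exact: measurable_cst.
  by apply/funext => w; rewrite /S /series /= big_geq.
have c0 : (0 <= c)%R.
  have := le_trans (mean_ge0 (v0 0%N)) (vc 0%N).
  by rewrite lee_fin expr0 mulr1.
have Sc n : mean (S n) <= (c * (2 - 2 * (2^-1) ^+ n))%:E.
  elim: n => [|n ih].
    rewrite (_ : S 0%N = fun=> 0%R).
      by rewrite mean_cst expr0 mulr1 subrr mulr0.
    by apply/funext => w; rewrite /S /series /= big_geq.
  rewrite SS meanD//; apply: le_trans (leeD ih (vc n)) _.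
  rewrite -EFinD lee_fin exprS; set e := (2^-1 ^+ n)%R.
  have : (0 <= e)%R by rewrite exprn_ge0.
  by nra.
have Sc2 : \forall n \near \oo, mean (S n) <= (c * 2)%:E.
  apply: nearW => n; apply: le_trans (Sc n) _; rewrite lee_fin ler_wpM2l//.
  by rewrite gerBl mulr_ge0// exprn_ge0.
have := mean_not_pinfty mS S0 Sc2.
apply: filterS => w; apply: contra_notP => ncvg.
apply: nondecreasing_dvgn_lt => //.
apply/nondecreasing_seqP => n.
by rewrite -/(S n w) -/(S n.+1 w) SS lerDl.
Qed.

(** Fatou's lemma for indicators; it carries tail bounds from a sequence to its almost sure
    limit. *)
Lemma measure_eventually_le (A_ : nat -> set T) (A : set T) (c : \bar R) :
  (forall n, measurable (A_ n)) -> measurable A ->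
  (\forall w \ae P, A w -> \forall n \near \oo, A_ n w) ->
  (\forall n \near \oo, P (A_ n) <= c) -> P A <= c.
Proof.
move=> mA_ mA AA Ac; rewrite -mean_indic//.
have := @fatou_mean (fun n => \1_(A_ n)) c.
move=> /(_ _ _ _)/wrap[].
- by move=> n; exact: measurable_indic.
- by move=> n w; rewrite indicE.
- by apply: filterS Ac => n; rewrite mean_indic.
apply: le_trans.
apply: ae_ge0_le_integral => //.
- by apply/measurable_EFinP; exact: measurable_indic.
- by move=> w _; apply: limn_einf_ge0 => n; rewrite indicE.
- by apply: measurable_limn_einf => n; exact: measurable_indic.
apply: filterS AA => w AA _.
have [Aw|nAw] := pselect (A w); last first.
  rewrite indicE memNset//.
  by apply: limn_einf_ge0 => n; rewrite indicE.
rewrite indicE mem_set//.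
have /cvg_limn_einf_sup[-> _]// : (fun n => (\1_(A_ n) w)%:E) @ \oo --> (1%:R : R)%:E.
apply: cvg_near_cst; apply: filterS (AA Aw) => n An.
by rewrite indicE mem_set.
Qed.

End mean.

(** * Convergence in probability and almost sure convergence *)

Section L0_topology.
Context d (T : measurableType d) (R : realType) (P : probability T R).
Implicit Types (f g h : L0 P) (C : set (L0 P)) (x : nat -> L0 P).

Lemma L0_lift (u : T -> R) : measurable_fun setT u ->
  exists f, \forall w \ae P, f w = u w.
Proof.
move=> mu.
pose X : {mfun T >-> R} := HB.pack u (@isMeasurableFun.Build _ _ _ _ u mu).
by exists (L0_of P X); exact: L0_ofE.
Qed.

Definition ae_cvg x g := \forall w \ae P, x ^~ w @ \oo --> g w.

Lemma L0_distE f g :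
  (L0_dist f g)%:E = mean P (fun w => Num.min 1 `|f w - g w|).
Proof.
rewrite /L0_dist unlock fineK//; apply: (@fin_num_mean _ _ _ _ _ 1).
- by meas.
- by move=> w; rewrite le_min ler01 normr_ge0.
apply: mean_le_cst; first by meas.
by move=> w; rewrite le_min ler01 normr_ge0 ge_min lexx.
Qed.

Lemma ae_cvg_dist x g : ae_cvg x g -> L0_dist (x n) g @[n --> \oo] --> (0 : R).
Proof.
move=> xg.
have : mean P (fun w => Num.min 1 `|x n w - g w|) @[n --> \oo] --> mean P (fun=> 0).
  apply: mean_cvg => //.
  - by move=> n; meas.
  - by move=> n w; rewrite le_min ler01 normr_ge0 ge_min lexx.
  apply: filterS xg => w xgw; apply/cvgrPdist_lt => e e0.
  move/cvgrPdist_lt : xgw => /(_ _ e0); apply: filterS => n.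
  move=> h; rewrite sub0r normrN ger0_norm ?le_min ?ler01 ?normr_ge0//.
  by rewrite gt_min distrC h orbT.
rewrite mean_cst; under eq_fun do rewrite -L0_distE.
exact: fine_cvg.
Qed.

Lemma closure_L0P C g : closure C g <->
  forall e : R, 0 < e -> exists2 h, C h & L0_dist g h < e.
Proof.
split=> [Cg e e0|Cg B].
  have [h [Ch gh]] := Cg _ (nbhsx_ballx g e e0).
  by exists h => //; move: gh; rewrite ballEmdist.
move=> /nbhs_ballP[e /= e0 eB]; have [h Ch gh] := Cg _ e0.
by exists h; split => //; apply: eB; rewrite ballEmdist.
Qed.

(** Points of [C] within 2^-n of [g] converge almost surely, because their truncated distances to
    [g] have summable means. Closures can thus be handled by pointwise limits. *)
Lemma closure_ae_cvgP C g :
  closure C g <-> exists2 x, (forall n, C (x n)) & ae_cvg x g.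
Proof.
split=> [/closure_L0P Cg|[x Cx xg]]; last first.
  apply/closure_L0P => e e0.
  have /cvgrPdist_lt/(_ _ e0)[N _ /(_ N (leqnn N))/=] := ae_cvg_dist xg.
  have dg0 : 0 <= L0_dist (x N) g.
    by rewrite -lee_fin L0_distE mean_ge0// => w; rewrite le_min ler01 normr_ge0.
  by rewrite sub0r normrN ger0_norm// L0_dist_sym => ?; exists (x N).
have : forall n : nat, exists h, C h /\ L0_dist g h < 1 * 2^-1 ^+ n.
  by move=> n; have [|h Ch gh] := Cg (1 * 2^-1 ^+ n); [rewrite mul1r exprn_gt0|exists h].
move=> /choice[x xP]; exists x => [n|]; first by have [] := xP n.
have : \forall w \ae P, cvgn (series (fun n => Num.min 1 `|g w - x n w|)).
  apply: (@mean_summable _ _ _ _ _ 1) => n.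
  - by meas.
  - by move=> w; rewrite le_min ler01 normr_ge0.
  - by rewrite -L0_distE lee_fin ltW//; have [] := xP n.
apply: filterS => w /cvg_series_cvg_0 xw; apply/cvgrPdist_lt => e e0.
have me0 : 0 < Num.min 1 e by rewrite lt_min ltr01.
move/cvgrPdist_lt : xw => /(_ _ me0); apply: filterS => n.
rewrite sub0r normrN ger0_norm ?le_min ?ler01 ?normr_ge0//.
by rewrite !lt_min !gt_min ltxx/= => /andP[+ /orP[e1|//]] => /lt_trans; apply.
Qed.

Definition mid f g : L0 P := (2^-1 : R) *: f + (2^-1 : R) *: g.

Lemma L0_lincombE (a b : R) f g :
  \forall w \ae P, (a *: f + b *: g : L0 P) w = a * f w + b * g w.
Proof.
apply: filterS3 (L0_addE (a *: f) (b *: g)) (L0_scaleE a f) (L0_scaleE b g).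
by move=> w -> -> ->.
Qed.

Lemma midE f g : \forall w \ae P, mid f g w = 2^-1 * f w + 2^-1 * g w.
Proof. exact: L0_lincombE. Qed.

End L0_topology.

(** * The penalty E[1 / (1 + f)] *)

Lemma harmonic_midpoint_gain (R : realFieldType) (x y : R) : 0 <= x -> 0 <= y ->
  (1 + (2^-1 * x + 2^-1 * y))^-1 + 4^-1 * ((1 + x)^-1 - (1 + y)^-1) ^+ 2 <=
  2^-1 * ((1 + x)^-1 + (1 + y)^-1).
Proof.
move=> x0 y0.
have a1 : 0 < 1 + x by lra.
have b1 : 0 < 1 + y by lra.
have ab : 0 < 1 + (2^-1 * x + 2^-1 * y) by lra.
rewrite -subr_ge0.
(* With X = 1 + x and Y = 1 + y this is (X - Y)^2 (2 X Y - X - Y) / (4 X^2 Y^2 (X + Y)); the sign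
   comes from X, Y >= 1. *)
have -> : 2^-1 * ((1 + x)^-1 + (1 + y)^-1) -
  ((1 + (2^-1 * x + 2^-1 * y))^-1 + 4^-1 * ((1 + x)^-1 - (1 + y)^-1) ^+ 2) =
  (x - y) ^+ 2 * (x + y + 2 * (x * y)) /
   (8 * (1 + x) ^+ 2 * (1 + y) ^+ 2 * (1 + (2^-1 * x + 2^-1 * y))).
  by field; rewrite ?lt0r_neq0//; lra.
apply: divr_ge0; first by rewrite mulr_ge0 ?sqr_ge0// !addr_ge0// !mulr_ge0.
by rewrite !mulr_ge0 ?exprn_ge0// ltW.
Qed.

(** A bound on [x] suffices because the truncation at 1 absorbs a large [y]: z (1 + y) <= z (1 + x)
    + z t <= t (2 + x) with t = |x - y| and z = min 1 t. The squared gap then comes from s <= e +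
    s^2 / (4 e). *)
Lemma min1_le_inverse_gap (R : realFieldType) (x y l e : R) :
  0 <= x -> 0 <= y -> x <= l -> 0 < e ->
  Num.min 1 `|x - y| <=
  e + (2 + l) ^+ 4 / (4 * e) * ((1 + x)^-1 - (1 + y)^-1) ^+ 2.
Proof.
move=> x0 y0 xl e0.
have a1 : 0 < 1 + x by lra.
have b1 : 0 < 1 + y by lra.
set r := (1 + x)^-1 - (1 + y)^-1; set z := Num.min 1 _.
have z0 : 0 <= z by rewrite le_min ler01 normr_ge0.
have zr : z <= (2 + l) ^+ 2 * `|r|.
  have -> : `|r| = `|x - y| / ((1 + x) * (1 + y)).
    rewrite (_ : r = - ((x - y) / ((1 + x) * (1 + y)))).
      by rewrite normrN normrM [X in _ * X]ger0_norm// invr_ge0 mulr_ge0// ltW.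
    by rewrite /r; field; rewrite !lt0r_neq0.
  rewrite mulrA ler_pdivlMr ?mulr_gt0//.
  set t := `|x - y| in z z0 *.
  have t0 : 0 <= t by exact: normr_ge0.
  have yt : y <= x + t by rewrite /t -lerBlDl distrC ler_norm.
  have zt : z <= t by rewrite ge_min lexx orbT.
  have z1 : z <= 1 by rewrite ge_min lexx.
  have h1 : z * (1 + y) <= t * (2 + x).
    apply: (@le_trans _ _ (z * (1 + x) + z * t)).
      by rewrite -mulrDr ler_wpM2l//; lra.
    have : z * t <= t by rewrite ler_piMl.
    have : z * (1 + x) <= t * (1 + x) by rewrite ler_wpM2r// ltW.
    by lra.
  rewrite (_ : z * _ = z * (1 + y) * (1 + x)); last by ring.
  apply: (@le_trans _ _ (t * (2 + x) * (1 + x))).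
    by rewrite ler_wpM2r// ltW.
  rewrite -mulrA [leRHS]mulrC ler_wpM2l//.
  rewrite expr2 ler_pM//; lra.
apply: le_trans zr _; rewrite -[r ^+ 2]real_normK ?num_real//.
set s := (2 + l) ^+ 2 * `|r|.
have -> : (2 + l) ^+ 4 / (4 * e) * `|r| ^+ 2 = s ^+ 2 / (4 * e).
  by rewrite /s; field; rewrite lt0r_neq0.
rewrite -subr_ge0 (_ : _ - s = (s - 2 * e) ^+ 2 / (4 * e)).
  by rewrite divr_ge0 ?sqr_ge0// mulr_ge0// ltW.
by field; rewrite lt0r_neq0.
Qed.

Section penalty.
Context d (T : measurableType d) (R : realType) (P : probability T R).
Implicit Types (f g h : L0 P) (C : set (L0 P)) (x : nat -> L0 P).

Let u f w : R := (1 + `|f w|)^-1.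

Let mu f : measurable_fun setT (u f).
Proof. by rewrite /u; meas. Qed.

Let u01 f w : 0 <= u f w <= 1.
Proof. by rewrite /u invr_ge0 addr_ge0//= invf_le1 ?lerDl// ltr_wpDr. Qed.

Let u0 f w : 0 <= u f w. Proof. by case/andP: (u01 f w). Qed.

Let gap01 f g w : 0 <= (u f w - u g w) ^+ 2 <= 1.
Proof.
rewrite sqr_ge0/= -(expr1n _ 2) -[leLHS]real_normK ?num_real// lerXn2r ?nnegrE//.
by have := u01 f w; have := u01 g w; rewrite ler_norml => /andP[? ?] /andP[? ?]; lra.
Qed.

Let mgap f g : measurable_fun setT (fun w => (u f w - u g w) ^+ 2).
Proof. by rewrite /u; meas. Qed.

(** The absolute value keeps the integrand in [0, 1] everywhere; on [L0_nneg] it changes nothing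
    almost surely. *)
Definition penalty f : R := fine (mean P (fun w => (1 + `|f w|)^-1)).

Definition penalty_gap f g : R :=
  fine (mean P (fun w => ((1 + `|f w|)^-1 - (1 + `|g w|)^-1) ^+ 2)).

Lemma penaltyE f : (penalty f)%:E = mean P (fun w => (1 + `|f w|)^-1).
Proof.
rewrite fineK//; apply: (@fin_num_mean _ _ _ _ _ 1); [exact: mu|exact: u0|].
by apply: mean_le_cst; [exact: mu|exact: u01].
Qed.

Lemma penalty_gapE f g : (penalty_gap f g)%:E =
  mean P (fun w => ((1 + `|f w|)^-1 - (1 + `|g w|)^-1) ^+ 2).
Proof.
rewrite fineK//; apply: (@fin_num_mean _ _ _ _ _ 1).
- exact: mgap.
- by move=> w; rewrite sqr_ge0.
- by apply: mean_le_cst; [exact: mgap|exact: gap01].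
Qed.

Lemma penalty_ge0 f : 0 <= penalty f.
Proof. by rewrite -lee_fin penaltyE; apply: mean_ge0; exact: u0. Qed.

Lemma penalty_le1 f : penalty f <= 1.
Proof.
by rewrite -lee_fin penaltyE; apply: mean_le_cst; [exact: mu|exact: u01].
Qed.

Lemma penalty_mid f g : L0_nneg P f -> L0_nneg P g ->
  penalty (mid f g) + 4^-1 * penalty_gap f g <= 2^-1 * (penalty f + penalty g).
Proof.
move=> f0 g0.
rewrite -lee_fin EFinD !EFinM EFinD !penaltyE penalty_gapE.
rewrite -meanD; [|exact: mu|exact: mu|exact: u0|exact: u0].
rewrite -meanZ//; [|exact: mgap|by move=> w; rewrite sqr_ge0].
rewrite -meanZ//; [|by apply: measurable_funD; exact: mu].
rewrite -meanD; [|exact: mu|by apply: measurable_funM => //; exact: mgap|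
  exact: u0|by move=> w; rewrite mulr_ge0// sqr_ge0].
apply: ae_le_mean.
- apply: measurable_funD; first exact: mu.
  by apply: measurable_funM => //; exact: mgap.
- by apply: measurable_funM => //; apply: measurable_funD; exact: mu.
- by move=> w; apply: addr_ge0; [exact: u0|rewrite mulr_ge0// sqr_ge0].
- by move=> w; rewrite mulr_ge0//; apply: addr_ge0; exact: u0.
apply: filterS3 f0 g0 (midE f g) => w fw gw ->.
rewrite (ger0_norm fw) (ger0_norm gw) ger0_norm; last by lra.
exact: harmonic_midpoint_gain.
Qed.

Definition L0_uniformly_tight C := forall e : R, 0 < e ->
  exists2 l : R, 0 <= l & forall f, C f -> (P [set w | (l < f w)%R] <= e%:E)%E.

Lemma measurable_lt_L0 (l : R) f : measurable [set w | l < f w].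
Proof.
rewrite -[X in measurable X]setTI.
by apply: (measurable_fun_ltr (measurable_cst l) (@L0_measurable _ _ _ _ f) measurableT
  (_ : measurable [set true])).
Qed.

Lemma penalty_cvg x g : ae_cvg x g ->
  penalty (x n) @[n --> \oo] --> penalty g.
Proof.
move=> xg; apply: fine_cvg; rewrite -/(penalty g) penaltyE.
apply: mean_cvg => //.
- by move=> n; exact: mu.
- by move=> n w; exact: u01.
- exact: mu.
apply: filterS xg => w xgw; apply: cvgV; first by rewrite lt0r_neq0// ltr_wpDr.
by apply: cvgD; [exact: cvg_cst|exact: cvg_norm].
Qed.

(** Uniformity in [g] rests on [min1_le_inverse_gap], which bounds only one of its two points; large
    values of [f] are discarded by tightness. *)
Lemma penalty_gap_dist f : L0_nneg P f -> L0_uniformly_tight [set f] ->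
  forall e, 0 < e -> exists2 c, 0 < c &
    forall g, L0_nneg P g -> penalty_gap f g <= c -> L0_dist f g < e.
Proof.
move=> f0 tf e e0.
(* Three terms of size at most [q] arise: the event [l < f], the constant in [min1_le_inverse_gap],
   and [k] times the gap. A fourth [q] makes the inequality strict. *)
have [q q0 qe] : exists2 q, 0 < q & q * 4 = e.
  by exists (e / 4); rewrite ?divfK ?divr_gt0.
have [l l0 /(_ f erefl) fl] := tf _ q0.
set k := (2 + l) ^+ 4 / (4 * (q)).
have k0 : 0 < k by apply: divr_gt0; [apply: exprn_gt0; lra|lra].
exists (q / k); first by rewrite divr_gt0.
move=> g g0 gap.
have : (L0_dist f g <= q + (q + k * penalty_gap f g)).
  rewrite -lee_fin !EFinD EFinM L0_distE penalty_gapE.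
  have kq w : 0 <= q + k * ((1 + `|f w|)^-1 - (1 + `|g w|)^-1) ^+ 2.
    by apply: addr_ge0; [exact: ltW|apply: mulr_ge0; [exact: ltW|exact: sqr_ge0]].
  have mA := measurable_lt_L0 l f.
  apply: (@le_trans _ _ (mean P (\1_[set w | (l < f w)%R]) + (mean P (fun=> q) +
     mean P (fun w => k * ((1 + `|f w|)^-1 - (1 + `|g w|)^-1) ^+ 2)%R))%E); last first.
    rewrite mean_indic// mean_cst meanZ; [|exact: mgap|
      by move=> w; rewrite sqr_ge0|exact: ltW].
    exact: leeD.
  rewrite -meanD; [|by meas|by meas|by move=> w; exact: ltW|
    by move=> w; apply: mulr_ge0; [exact: ltW|exact: sqr_ge0]].
  rewrite -meanD; [|exact: measurable_indic|by meas|by move=> w; rewrite indicE|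
    exact: kq].
  apply: ae_le_mean => //.
  - by meas.
  - by apply: measurable_funD; [exact: measurable_indic|meas].
  - by move=> w; apply: addr_ge0; [rewrite indicE|exact: kq].
  apply: filterS2 f0 g0 => w fw gw.
  rewrite indicE; have [flw|lfw] := leP (f w) l.
    rewrite memNset/= ?add0r; last by apply/negP; rewrite -leNgt.
    rewrite (ger0_norm fw) (ger0_norm gw).
    exact: min1_le_inverse_gap.
  rewrite mem_set//; apply: (@le_trans _ _ 1); first by rewrite ge_min lexx.
  by rewrite lerDl; exact: kq.
have : k * penalty_gap f g <= q by rewrite mulrC -ler_pdivlMr.
lra.
Qed.

End penalty.

(** * Almost sure limits of penalty-minimizing sequences *)

Section extraction.
Context d (T : measurableType d) (R : realType) (P : probability T R).
Implicit Types (f g h : L0 P) (C : set (L0 P)) (x : nat -> L0 P).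

(** The variables 1 / (1 + x n) have increments with summable means, hence converge almost surely;
    tightness forbids the limit 0, so the limit can be inverted. *)
Lemma ae_cvg_of_summable_penalty_gap C x (c : R) :
  L0_uniformly_tight C -> C `<=` L0_nneg P -> (forall n, C (x n)) ->
  (forall n, penalty_gap (x n) (x n.+1) <= c * 4^-1 ^+ n) ->
  exists2 g, L0_nneg P g & ae_cvg x g.
Proof.
move=> tC C0 Cx gap.
pose u n w : R := (1 + `|x n w|)^-1.
have u01 n w : 0 <= u n w <= 1.
  by rewrite /u invr_ge0 addr_ge0//= invf_le1 ?lerDl// ltr_wpDr.
have mu n : measurable_fun setT (u n) by rewrite /u; meas.
have mgap n : measurable_fun setT (fun w => (u n w - u n.+1 w) ^+ 2).
  by apply: measurable_funX; apply: measurable_funB.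
have ucvg : \forall w \ae P, cvgn (u ^~ w).
  have : \forall w \ae P, cvgn (series (fun n => `|u n w - u n.+1 w|)).
    apply: (@mean_summable _ _ _ _ _ (2^-1 + 2^-1 * c)) => n.
    - by apply: measurableT_comp => //; apply: measurable_funB.
    - by move=> w.
    have e0 : 0 < 2^-1 ^+ n :> R by rewrite exprn_gt0.
    have E0 : 0 < 2 ^+ n :> R by rewrite exprn_gt0.
    have z0 w : 0 <= 2^-1 * 2 ^+ n * (u n w - u n.+1 w) ^+ 2.
      by apply: mulr_ge0; rewrite ?sqr_ge0// mulr_ge0// ltW.
    have eE : 2^-1 ^+ n * 2 ^+ n = 1 :> R by rewrite -exprMn mulVf// expr1n.
    have ee : 4^-1 ^+ n = 2^-1 ^+ n * 2^-1 ^+ n :> R.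
      by rewrite -exprMn; congr (_ ^+ _); lra.
    (* The inequality z <= 2^-1 2^-n + 2^-1 2^n z^2 stands in for Cauchy-Schwarz and turns gaps of
       order 4^-n into means of order 2^-n. *)
    apply: (@le_trans _ _ (mean P (fun=> (2^-1 * 2^-1 ^+ n)%R) +
        mean P (fun w => (2^-1 * 2 ^+ n) * (u n w - u n.+1 w) ^+ 2)%R)%E).
      rewrite -meanD; [|by meas|by apply: measurable_funM|
        by move=> w; rewrite mulr_ge0// ltW|exact: z0].
      apply: ae_le_mean => //.
      - by apply: measurableT_comp => //; apply: measurable_funB.
      - by apply: measurable_funD => //; apply: measurable_funM.
      - by move=> w; apply: addr_ge0 (z0 w); rewrite mulr_ge0// ltW.
      apply: aeW => w; rewrite -[(u n w - _) ^+ 2]real_normK ?num_real//.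
      move: (`|_|) => z.
      have : 0 <= 2 ^+ n * (z - 2^-1 ^+ n) ^+ 2.
        by rewrite mulr_ge0 ?sqr_ge0// ltW.
      have -> : 2 ^+ n * (z - 2^-1 ^+ n) ^+ 2 =
          2 ^+ n * z ^+ 2 - 2 * (2^-1 ^+ n * 2 ^+ n) * z +
          (2^-1 ^+ n * 2 ^+ n) * 2^-1 ^+ n by ring.
      rewrite eE; lra.
    rewrite mean_cst meanZ; [|exact: mgap|by move=> w; rewrite sqr_ge0|
      by rewrite mulr_ge0// ltW].
    rewrite -penalty_gapE -EFinM -EFinD lee_fin.
    rewrite [leRHS]mulrDl lerD2l -!mulrA ler_pM2l//.
    rewrite mulrC -ler_pdivlMr//.
    apply: le_trans (gap n) _; rewrite ee.
    by rewrite (_ : (2 ^+ n)^-1 = 2^-1 ^+ n) ?mulrA ?exprVn.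
  apply: filterS => w /normed_cvg.
  rewrite (_ : (fun n => _) = - telescope (u ^~ w)); last first.
    by apply/funext => n; rewrite /telescope/= opprB.
  rewrite seriesN => /is_cvgN; rewrite opprK telescopeK => cu.
  rewrite (_ : u ^~ w = (fun n => u n w - u 0%N w) + cst (u 0%N w)).
    by apply: is_cvgD => //; exact: is_cvg_cst.
  by apply/funext => n; rewrite /= /cst addrfctE subrK.
(* The upper limit is measurable and equals the limit wherever there is one. *)
pose v w := limn_sup (u ^~ w).
have uv : \forall w \ae P, u ^~ w @ \oo --> v w.
  by apply: filterS ucvg => w cu; rewrite /v cvg_limn_supE.
have mv : measurable_fun setT v.
  apply: measurable_fun_limn_sup => [w _|w _|n] //.
  - by exists 1 => _ [n _ <-]; case/andP: (u01 n w).
  - by exists 0 => _ [n _ <-]; case/andP: (u01 n w).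
have v01 : \forall w \ae P, 0 <= v w <= 1.
  apply: filterS uv => w uvw; apply/andP; split.
    by apply: (cvgr_to_ge uvw); apply: nearW => n; case/andP: (u01 n w).
  by apply: (cvgr_to_le uvw); apply: nearW => n; case/andP: (u01 n w).
have x0 : \forall w \ae P, forall n, 0 <= x n w.
  by apply: ae_foralln => n; exact: C0.
(* Where [v w <= 0] the values [x n w] eventually exceed every level [l]; by tightness such an event
   has probability at most [e], for every [e]. *)
have v0 : \forall w \ae P, 0 < v w.
  have mA : measurable [set w | v w <= 0].
    have := mv measurableT _ (measurable_itv `]-oo, 0 : R]); rewrite setTI.
    by congr measurable; apply/seteqP; split => w /=; rewrite in_itv.
  have PA : P [set w | v w <= 0] = 0%E.
    apply/eqP; rewrite eq_le measure_ge0 andbT.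
    apply/lee_addgt0Pr => e e0; rewrite add0e.
    have [l l0 Cl] := tC _ e0.
    apply: (measure_eventually_le (A_ := fun n => [set w | l < x n w])) => //.
    - by move=> n; exact: measurable_lt_L0.
    - apply: filterS2 uv x0 => w uvw xw vw /=.
      have : v w < (1 + l)^-1 by rewrite (le_lt_trans vw)// invr_gt0 ltr_pwDl.
      move=> /(cvgr_lt _ uvw); apply: filterS => n.
      have p1 : 1 + x n w \is Num.pos by rewrite posrE ltr_pwDl.
      have p2 : 1 + l \is Num.pos by rewrite posrE ltr_pwDl.
      by rewrite /u ger0_norm// ltf_pV2// ltrD2l.
    - by apply: nearW => n; exact: Cl.
  exists [set w | v w <= 0]; split => //.
  by move=> w /= /negP; rewrite -leNgt.
have [g gE] : exists g : L0 P, \forall w \ae P, g w = (v w)^-1 - 1.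
  by apply: L0_lift; apply: measurable_funB => //; exact: measurable_funV.
exists g.
  apply: filterS3 gE v01 v0 => w -> /andP[_ v1] v0.
  by rewrite subr_ge0 invf_ge1.
have gv : \forall w \ae P, g w = (v w)^-1 - 1 /\ 0 < v w by apply: filterS2 gE v0.
apply: filterS3 gv uv x0 => w [-> vw] uvw xw.
rewrite (_ : x ^~ w = (fun n => (u n w)^-1 - 1)).
  apply: cvgB; last exact: cvg_cst.
  by apply: cvgV => //; rewrite lt0r_neq0.
by apply/funext => n; rewrite /u invrK ger0_norm// addrC addKr.
Qed.

(* A Komlos-type extraction: strict convexity of the penalty makes
   near-minimizers Cauchy, so no convex combinations need to be taken. *)
Lemma penalty_minimizing_cvg C (D : nat -> set (L0 P)) :
  L0_uniformly_tight C -> C `<=` L0_nneg P ->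
  (forall n, D n `<=` C) -> (forall n, D n !=set0) ->
  (forall m n, (m <= n)%N -> D n `<=` D m) ->
  (forall n f g, D n f -> D n g -> D n (mid f g)) ->
  exists x g, [/\ forall n, D n (x n), L0_nneg P g, ae_cvg x g &
    forall n, exists m, forall h, D m h -> penalty (x n) <= penalty h + 4^-1 ^+ n].
Proof.
move=> tC C0 DC Dn0 Dle Dmid.
pose s n := inf [set penalty h | h in D n].
have hi n : has_inf [set penalty h | h in D n].
  split; first by have [h Dh] := Dn0 n; exists (penalty h), h.
  by exists 0 => _ [h _ <-]; exact: penalty_ge0.
have s_lb n h : D n h -> s n <= penalty h.
  by move=> Dh; apply: ge_inf; [case: (hi n)|exists h].
have snd : nondecreasing_seq s.
  move=> m n mn; apply: lb_le_inf; first by case: (hi n).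
  by move=> _ [h Dh <-]; apply: s_lb; exact: Dle Dh.
have sub : has_ubound (range s).
  exists 1 => _ [n _ <-]; have [h Dh] := Dn0 n.
  by apply: le_trans (s_lb _ _ Dh) (penalty_le1 h).
pose S := sup (range s).
have sS n : s n <= S by apply: ub_le_sup => //; exists n.
have e0 n : 0 < 4^-1 ^+ n :> R by rewrite exprn_gt0.
(* [s (N j)] is within 4^-j of the supremum [S] of the infima; [j <= N] puts a point of [D N] also
   in [D j]. *)
have /choice[N NP] : forall j, exists N, (j <= N)%N /\ S - 4^-1 ^+ j < s N.
  move=> j; have hs : has_sup (range s) by split => //; exists (s 0%N), 0%N.
  have [_ [N _ <-] SN] := sup_adherent (e0 j) hs.
  exists (maxn j N); rewrite leq_maxl; split => //.
  by apply: lt_le_trans SN _; apply: snd; exact: leq_maxr.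
have /choice[x xP] : forall j, exists h, D (N j) h /\ penalty h < s (N j) + 4^-1 ^+ j.
  move=> j; have [_ [h Dh <-] hs] := inf_adherent (e0 j) (hi (N j)).
  by exists h.
have Dx n : D n (x n) by have [jN _] := NP n; apply: Dle jN _ _; have [] := xP n.
(* Consecutive points lie in a common [D m] with [s m > S - 4^-n] and have penalties below
   [S + 4^-n]. Their midpoint has penalty at least [s m], so a quarter of the gap is below 2 * 4^-n;
   hence the constant 8. *)
have [//|//|n|n|g g0 xg] := @ae_cvg_of_summable_penalty_gap C x 8.
- exact: DC (Dx n).
- have [m [Dm Dm1 sm]] : exists m, [/\ D m (x n), D m (x n.+1) & S - 4^-1 ^+ n < s m].
    have [D1 _] := xP n; have [D2 _] := xP n.+1.
    have [_ s1] := NP n; have [_ s2] := NP n.+1.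
    have [le|/ltnW le] := leqP (N n) (N n.+1).
      by exists (N n); split => //; exact: Dle le _ D2.
    exists (N n.+1); split => //; first exact: Dle le _ D1.
    apply: le_lt_trans s2; rewrite lerD2l lerN2 exprS ler_piMl// ?ltW//.
    by lra.
  have := s_lb _ _ (Dmid _ _ _ Dm Dm1).
  have [_ p1] := xP n; have [_ p2] := xP n.+1.
  have := sS (N n); have := sS (N n.+1).
  have := penalty_mid (C0 _ (DC _ _ Dm)) (C0 _ (DC _ _ Dm1)).
  have e1 : 4^-1 ^+ n.+1 <= 4^-1 ^+ n :> R.
    by rewrite exprS ler_piMl// ?ltW//; lra.
  lra.
exists x, g; split => // n; exists (N n) => h Dh.
have [_ p1] := xP n; have := s_lb _ _ Dh; lra.
Qed.

End extraction.

(** * Numeraires are maximal *)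

Section density_probability.
Context d (T : measurableType d) (R : realType) (P : probability T R).
Variable q : T -> R.
Hypotheses (mq : measurable_fun setT q) (q0 : forall w, 0 <= q w).
Hypothesis q1 : mean P q = 1%E.
Local Open Scope ereal_scope.

Let Q A := \int[P]_(w in A) (q w)%:E.

Let Q_set0 : Q set0 = 0. Proof. exact: integral_set0. Qed.

Let Q_ge0 A : 0 <= Q A.
Proof. by apply: integral_ge0 => w _; rewrite lee_fin. Qed.

Let Q_sigma_additive : semi_sigma_additive Q.
Proof.
apply: semi_sigma_additive_nng_induced; first exact/measurable_EFinP.
by move=> w; rewrite lee_fin.
Qed.

HB.instance Definition _ :=
  isMeasure.Build _ _ _ Q Q_set0 Q_ge0 Q_sigma_additive.

HB.instance Definition _ := Measure_isProbability.Build _ _ _ Q q1.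

(** If Q A = 0 then [q] vanishes almost everywhere on A, so positivity of [q] makes A null for P. *)
Lemma density_probability : (\forall w \ae P, 0 < q w)%R ->
  exists Q : probability T R, [/\ Q `<< P, P `<< Q &
    forall v : T -> R, measurable_fun setT v -> (forall w, 0 <= v w)%R ->
      mean Q v = mean P (fun w => v w * q w)%R].
Proof.
move=> qpos; have QP : (Q : probability T R) `<< P.
  apply/null_content_dominatesP => A mA PA0 /=; rewrite /Q.
  apply: null_set_integral => //.
  exact/measurable_funTS/measurable_EFinP.
exists Q; split => //.
- apply/null_content_dominatesP => A mA QA0.
  have : \forall w \ae P, (q w * \1_A w = 0)%R.
    apply: mean_eq0; first by apply: measurable_funM => //; exact: measurable_indic.
      by move=> w; rewrite mulr_ge0// indicE.
    rewrite -[leRHS]QA0 /= /Q integral_mkcond /mean.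
    rewrite le_eqVlt; apply/orP; left; apply/eqP; apply: eq_integral => w _.
    rewrite patchE indicE; case: ifPn => _; first by rewrite mulr1.
    by rewrite mulr0.
  move=> qA; apply/eqP; rewrite eq_le measure_ge0 andbT.
  rewrite -mean_indic// -[leRHS](mean_cst P 0).
  apply: ae_le_mean => //.
  apply: filterS2 qA qpos => w /eqP; rewrite mulf_eq0 => /orP[/eqP ->|/eqP ->//].
  by rewrite ltxx.
move=> v mv v0.
pose f := Radon_Nikodym_SigmaFinite.f (Q : probability T R) P.
(* The Radon-Nikodym derivative of [Q] has the same integrals over measurable sets as [q], so the
   change of variables can be read with [q]. *)
have fq : ae_eq P setT f (EFin \o q).
  apply: integral_ae_eq => //.
  - exact: Radon_Nikodym_SigmaFinite.f_integrable.
  - exact/measurable_EFinP.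
  - by move=> E _ mE; rewrite -Radon_Nikodym_SigmaFinite.f_integral.
rewrite /mean -(Radon_Nikodym_SigmaFinite.change_of_variables QP)//; last first.
  exact/measurable_EFinP.
apply: ae_eq_integral => //.
- apply: emeasurable_funM; first exact/measurable_EFinP.
  exact/measurable_int/Radon_Nikodym_SigmaFinite.f_integrable.
- by apply/measurable_EFinP; apply: measurable_funM.
by apply: filterS fq => w /[apply]; rewrite -/f => ->; rewrite EFinM.
Qed.

End density_probability.

Section numeraire_maximal.
Context d (T : measurableType d) (R : realType) (P : probability T R).
Implicit Types (f g h : L0 P) (C : set (L0 P)).

Lemma null_dominates_ae (mu nu : {measure set T -> \bar R}) (A : T -> Prop) :
  nu `<< mu -> (\forall w \ae mu, A w) -> \forall w \ae nu, A w.
Proof.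
move=> /null_content_dominatesP numu [N [mN N0 AN]].
by exists N; split => //; exact: numu.
Qed.

Lemma expectation_ratioE (Q : probability T R) f g : Q `<< P ->
  L0_nneg P f -> L0_pos P g ->
  ('E_Q[fun w => (f w / g w)%R] = mean Q (fun w => `|f w| / `|g w|)%R)%E.
Proof.
move=> QP f0 g0; rewrite unlock; apply: ae_eq_integral => //.
- by apply/measurable_EFinP; meas.
- by apply/measurable_EFinP; meas.
apply: (null_dominates_ae QP).
by apply: filterS2 f0 g0 => w fw gw _; rewrite ger0_norm// gtr0_norm.
Qed.

(** If f >= g then f / g >= 1 has Q-mean at most 1, hence equals 1 almost surely. [Q << P] carries
    the inequality to Q, and [P << Q] carries the equality back. *)
Lemma numeraire_maximal C : C `<=` L0_nneg P -> numeraire C `<=` maximal C.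
Proof.
move=> C0 g [Cg g0 [Q [QP PQ Qg]]]; split => // f Cf gf.
have := Qg _ Cf; rewrite expectation_ratioE//; last exact: C0.
rewrite -(mean_cst Q 1) => fg1.
have r0 w : 0 <= `|f w| / `|g w| by rewrite divr_ge0.
have : \forall w \ae Q, 1 = `|f w| / `|g w|.
  apply: (@mean_le_ae_eq _ _ _ _ (fun=> 1)) => //.
  - by meas.
  - apply: (null_dominates_ae QP); apply: filterS2 gf g0 => w gf g0.
    rewrite ler_pdivlMr ?mul1r ?normr_gt0 ?lt0r_neq0//.
    by rewrite !ger0_norm// ltW// (lt_le_trans g0).
  - by rewrite mean_cst ltry.
move=> /(null_dominates_ae PQ) e1; apply/L0_eqP.
apply: filterS3 (C0 _ Cf) g0 e1 => w f0 g0' /esym/eqP.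
rewrite ger0_norm// gtr0_norm// -(divff (lt0r_neq0 g0')).
by move=> /eqP /(mulIf _) ->//; rewrite invr_neq0// lt0r_neq0.
Qed.

End numeraire_maximal.

(** * Existence of numeraires *)

Section power_inequalities.
Variable R : realFieldType.
Implicit Types a x y t r : R.

Lemma expr_midpoint_le k x y : 0 <= x -> 0 <= y ->
  (2^-1 * x + 2^-1 * y) ^+ k <= 2^-1 * x ^+ k + 2^-1 * y ^+ k.
Proof.
move=> x0 y0; elim: k => [|k ih]; first by rewrite !expr0; lra.
have xk : 0 <= x ^+ k by exact: exprn_ge0.
have yk : 0 <= y ^+ k by exact: exprn_ge0.
rewrite !exprS.
apply: (@le_trans _ _ ((2^-1 * x + 2^-1 * y) * (2^-1 * x ^+ k + 2^-1 * y ^+ k))).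
  by rewrite ler_wpM2l// addr_ge0// mulr_ge0.
(* Up to a factor 1/4, this product is the mean of the [k.+1]-th powers minus the product of the two
   means. *)
have : 0 <= (x - y) * (x ^+ k - y ^+ k).
  have [xy|/ltW yx] := leP x y.
    by rewrite mulr_le0// subr_le0// lerXn2r.
  by rewrite mulr_ge0// subr_ge0// lerXn2r.
move: (x ^+ k) (y ^+ k) => X Y; lra.
Qed.

Lemma inverse_midpoint_le k a x y : 0 <= a -> 0 < x -> 0 < y ->
  (a / (2^-1 * x + 2^-1 * y)) ^+ k <= 2^-1 * (a / x) ^+ k + 2^-1 * (a / y) ^+ k.
Proof.
move=> a0 x0 y0.
have ax : 0 <= a / x by rewrite divr_ge0// ltW.
have ay : 0 <= a / y by rewrite divr_ge0// ltW.
apply: le_trans (expr_midpoint_le k ax ay).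
have xy : 0 < 2^-1 * x + 2^-1 * y by lra.
apply: lerXn2r; rewrite ?nnegrE.
- by rewrite divr_ge0// ltW.
- by rewrite addr_ge0// mulr_ge0.
rewrite -subr_ge0.
have -> : 2^-1 * (a / x) + 2^-1 * (a / y) - a / (2^-1 * x + 2^-1 * y) =
    a * (x - y) ^+ 2 / (4 * (x * y) * (2^-1 * x + 2^-1 * y)).
  by field; rewrite ?lt0r_neq0//; lra.
rewrite divr_ge0//; first by rewrite mulr_ge0// sqr_ge0.
by apply: mulr_ge0; [apply: mulr_ge0 => //; apply: mulr_ge0|]; exact: ltW.
Qed.

(* The tangent line of [z |-> z ^+ k.+1] at [y], evaluated at [1]. *)
Lemma expr_tangent_le k y : 0 <= y -> k.+1%:R * y ^+ k <= 1 + k%:R * y ^+ k.+1.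
Proof.
move=> y0; elim: k => [|k ih]; first by rewrite !mul1r expr0 mul0r addr0.
have : 0 <= k.+1%:R * y ^+ k * (1 - y) ^+ 2.
  by rewrite mulr_ge0 ?sqr_ge0// mulr_ge0// exprn_ge0.
move: ih; rewrite !exprS -[k.+2]addn1 -[k.+1]addn1 !natrD.
have := exprn_ge0 k y0; move: (y ^+ k) => Y; move: (k%:R : R) => K.
rewrite ?expr0 => ? h1 h2.
have -> : (K + 1 + 1) * (y * Y) = (K + 1) * Y - K * (y * Y) +
  ((K + 1) * (y * (y * Y))) - (K + 1) * Y * (1 - y) ^+ 2 by ring.
lra.
Qed.

(* First-order inequality at the point [X = 1 - t + t * r] for the convex
   function [X |-> X ^- k], with the term in [r] isolated. *)
Lemma inverse_tangent_le k t r : 0 < t < 1 -> 0 <= r ->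
  (1 - t + t * r)^-1 ^+ k + k%:R * t * ((1 - t + t * r)^-1 ^+ k.+1 * r) <=
  1 + k%:R * t * (1 - t)^-1 ^+ k.+1.
Proof.
move=> /andP[t0 t1] r0.
have t10 : 0 < 1 - t by lra.
have tr0 : 0 <= t * r by rewrite mulr_ge0// ltW.
have X0 : 0 < 1 - t + t * r by lra.
set y := (1 - t + t * r)^-1.
have y0 : 0 <= y by rewrite invr_ge0 ltW.
have yt : y <= (1 - t)^-1 by rewrite lef_pV2 ?posrE//; lra.
have tan := expr_tangent_le k y0.
have E : y ^+ k.+1 * (t * r) = y ^+ k - (1 - t) * y ^+ k.+1.
  have yX : y * (1 - t + t * r) = 1 by rewrite mulVf// lt0r_neq0.
  rewrite (_ : y ^+ k.+1 * (t * r) =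
    y ^+ k * (y * (1 - t + t * r)) - (1 - t) * y ^+ k.+1).
    by rewrite yX mulr1.
  by rewrite exprS; ring.
have -> : k%:R * t * (y ^+ k.+1 * r) = k%:R * (y ^+ k.+1 * (t * r)) by ring.
rewrite E.
(* Replacing [y] by its bound frees the right-hand side of [r], so that its integral against the
   weight is finite whatever [r] is. *)
have : k%:R * t * y ^+ k.+1 <= k%:R * t * (1 - t)^-1 ^+ k.+1.
  apply: ler_wpM2l; first by rewrite mulr_ge0// ltW.
  by apply: lerXn2r => //; rewrite nnegrE invr_ge0 ltW.
move: tan; rewrite -[in k.+1%:R]addn1 natrD.
move: (y ^+ k.+1) ((1 - t)^-1 ^+ k.+1) (y ^+ k) (k%:R : R) => Y Z W K.
lra.
Qed.

End power_inequalities.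

(** * The functional E[(a / h)^k] and its minimizers *)

Section power_ratio.
Context d (T : measurableType d) (R : realType) (P : probability T R).
Implicit Types (f g h : L0 P) (x : nat -> L0 P).

Definition L0_convex (K : set (L0 P)) := forall f g (t : R), 0 <= t <= 1 ->
  K f -> K g -> K ((1 - t) *: f + t *: g).

Definition ae_closed (K : set (L0 P)) := forall x g,
  (forall n, K (x n)) -> ae_cvg x g -> K g.

(** Where [f] vanishes, the convention 0^-1 = 0 makes the ratio 0 instead of infinite; this is why
    the minimization runs over strictly positive elements. *)
Definition power_ratio k (a f : L0 P) : \bar R :=
  mean P (fun w => (`|a w| / `|f w|) ^+ k).

Let ratio k (a f : L0 P) w := (`|a w| / `|f w|) ^+ k.

Let ratio_ge0 k a f w : 0 <= ratio k a f w.
Proof. by rewrite exprn_ge0// divr_ge0. Qed.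

Let mratio k a f : measurable_fun setT (ratio k a f).
Proof. by rewrite /ratio; meas. Qed.

Variables (K : set (L0 P)) (a : L0 P) (k : nat).
Hypotheses (K_tight : L0_uniformly_tight K) (K0 : K `<=` L0_nneg P).
Hypotheses (K_convex : L0_convex K) (K_closed : ae_closed K).
Hypotheses (Ka : K a) (a_pos : L0_pos P a) (k_gt0 : (0 < k)%N).

Let K_mid f g : K f -> K g -> K (mid f g).
Proof.
move=> Kf Kg; have := @K_convex f g 2^-1.
rewrite (_ : 1 - 2^-1 = 2^-1); last by lra.
by apply => //; lra.
Qed.

Let a0 : \forall w \ae P, 0 <= a w. Proof. exact: K0. Qed.

Lemma power_ratio_self : power_ratio k a a = 1%E.
Proof.
rewrite -(mean_cst P 1); apply: ae_eq_integral => //.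
- exact/measurable_EFinP/mratio.
by apply: filterS a_pos => w aw _; rewrite divff ?expr1n// normr_eq0 lt0r_neq0.
Qed.

Lemma power_ratio_mid (c : R) f g : L0_pos P f -> L0_pos P g ->
  (power_ratio k a f <= c%:E -> power_ratio k a g <= c%:E ->
   power_ratio k a (mid f g) <= c%:E)%E.
Proof.
move=> f0 g0 fc gc.
apply: (@le_trans _ _ (2^-1%:E * power_ratio k a f + 2^-1%:E * power_ratio k a g)%E).
  have m2 h : measurable_fun setT (fun w => 2^-1 * ratio k a h w).
    by apply: measurable_funM => //; exact: mratio.
  have p2 h w : 0 <= 2^-1 * ratio k a h w by rewrite mulr_ge0.
  have half0 : 0 <= 2^-1 :> R by [].
  rewrite -(meanZ P (mratio k a f) (ratio_ge0 k a f) half0).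
  rewrite -(meanZ P (mratio k a g) (ratio_ge0 k a g) half0).
  rewrite -meanD; [|exact: m2|exact: m2|exact: p2|exact: p2].
  apply: ae_le_mean.
  - exact: mratio.
  - by apply: measurable_funD; exact: m2.
  - exact: ratio_ge0.
  - by move=> w; apply: addr_ge0; exact: p2.
  apply: filterS3 f0 g0 (midE f g) => w fw gw; rewrite /ratio => ->.
  have fgw : 0 < 2^-1 * f w + 2^-1 * g w by lra.
  rewrite (gtr0_norm fw) (gtr0_norm gw) (gtr0_norm fgw).
  exact: inverse_midpoint_le.
rewrite (_ : c%:E = (2^-1%:E * c%:E + 2^-1%:E * c%:E)%E); last first.
  by rewrite -!EFinM -EFinD; congr EFin; lra.
by apply: leeD; apply: lee_pmul => //; [exact: mean_ge0 (ratio_ge0 _ _ _)|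
  exact: mean_ge0 (ratio_ge0 _ _ _)].
Qed.

(* A vanishing limit would force the ratios to infinity, which Fatou's lemma
   excludes. *)
Lemma ae_cvg_power_ratio_pos (c : R) x g : ae_cvg x g ->
  (forall n, L0_pos P (x n)) -> L0_nneg P g ->
  (forall n, power_ratio k a (x n) <= c%:E)%E -> L0_pos P g.
Proof.
move=> xg x0 g0 xc.
have := @mean_not_pinfty _ _ _ P (fun n => ratio k a (x n)) c.
move=> /(_ _ _ _)/wrap[].
- by move=> n; exact: mratio.
- by move=> n w; exact: ratio_ge0.
- by apply: nearW => n; exact: xc.
move=> npinf.
have {}x0 : \forall w \ae P, forall n, 0 < x n w by apply: ae_foralln.
have xg0 : \forall w \ae P, x ^~ w @ \oo --> g w /\ forall n, 0 < x n w.
  by apply: filterS2 xg x0.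
have ag0 : \forall w \ae P, 0 < a w /\ 0 <= g w by apply: filterS2 a_pos g0.
apply: filterS3 npinf xg0 ag0 => w nw [xw xp] [aw gw].
rewrite lt_neqAle gw andbT; apply/eqP => gw0; apply: nw.
apply/cvgryPge => A.
(* A ratio at least 1 is bounded by its [k]-th power, so passing [B] is enough to pass [A]. *)
pose B := Num.max A 1.
have B1 : 1 <= B by rewrite le_max lexx orbT.
have B0 : 0 < B by lra.
have aB : 0 < a w / B by rewrite divr_gt0.
rewrite -gw0 in xw.
apply: filterS (cvgr_lt _ xw (a w / B) aB) => n xa.
rewrite /ratio (gtr0_norm aw) (gtr0_norm (xp n)).
have Bx : B <= a w / x n w.
  by rewrite ler_pdivlMr// mulrC -ler_pdivlMr// ltW.
apply: (@le_trans _ _ B); first by rewrite le_max lexx.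
apply: le_trans Bx _; apply: ler_eXnr => //.
by apply: le_trans B1 _; rewrite ler_pdivlMr// mulrC -ler_pdivlMr// ltW.
Qed.

Lemma power_ratio_lsc (c : \bar R) x g : ae_cvg x g -> L0_pos P g ->
  (\forall n \near \oo, power_ratio k a (x n) <= c)%E ->
  (power_ratio k a g <= c)%E.
Proof.
move=> xg g0; apply: mean_fatou.
- by move=> n; exact: mratio.
- by move=> n w; exact: ratio_ge0.
- exact: mratio.
- exact: ratio_ge0.
apply: filterS2 xg g0 => w xw gw.
have xgw : `|a w| / `|x n w| @[n --> \oo] --> `|a w| / `|g w|.
  apply: cvgM; first exact: cvg_cst.
  by apply: cvgV; [rewrite normr_eq0 lt0r_neq0|exact: cvg_norm].
exact: (@cvg_comp _ _ _ (fun n => `|a w| / `|x n w|) (fun z : R => z ^+ k)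
  _ _ _ xgw (@exprn_continuous _ k _)).
Qed.

(** Any sequence with its n-th term in the n-th sublevel set [D n] is minimizing; the penalty serves
    to select one that converges. *)
Lemma power_ratio_minimizer : exists g, [/\ K g, L0_pos P g &
  forall h, K h -> L0_pos P h -> (power_ratio k a g <= power_ratio k a h)%E].
Proof.
pose V := [set power_ratio k a h | h in K `&` L0_pos P].
have I0 : (0 <= ereal_inf V)%E.
  by apply: le_ereal_inf_tmp => _ [h _ <-]; exact: mean_ge0 (ratio_ge0 _ _ _).
have I1 : (ereal_inf V <= 1)%E.
  by rewrite -power_ratio_self; apply: ereal_inf_lbound; exists a.
have Ifin : ereal_inf V \is a fin_num.
  by rewrite ge0_fin_numE// (le_lt_trans I1)// ltry.
pose c := fine (ereal_inf V).
have cE : c%:E = ereal_inf V by rewrite fineK.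
pose D (n : nat) := [set f | [/\ K f, L0_pos P f &
  (power_ratio k a f <= (c + n.+1%:R^-1)%:E)%E]].
have [||||||x [g [Dx g0 xg _]]] := @penalty_minimizing_cvg _ _ _ P K D => //.
- by move=> n f [].
- move=> n; have n0 : 0 < n.+1%:R^-1 :> R by [].
  have [_ [f [Kf f0] <-] fI] := lb_ereal_inf_adherent n0 Ifin.
  by exists f; split => //; rewrite EFinD cE ltW.
- move=> m n mn f [Kf f0 fc]; split => //; apply: le_trans fc _.
  by rewrite lee_fin lerD2l lef_pV2 ?posrE// ler_nat ltnS.
- move=> n f h [Kf f0 fc] [Kh h0 hc]; split; first exact: K_mid.
    apply: filterS3 f0 h0 (midE f h) => w fw hw ->; lra.
  exact: power_ratio_mid.
have Kg : K g by apply: (K_closed _ xg) => n; have [] := Dx n.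
have gpos : L0_pos P g.
  apply: (@ae_cvg_power_ratio_pos (c + 1) x) => // n; first by have [] := Dx n.
  have [_ _ xc] := Dx n; apply: le_trans xc _.
  by rewrite lee_fin lerD2l invf_le1// ler1n.
exists g; split => // h Kh h0.
have : (power_ratio k a g <= ereal_inf V)%E.
  apply/lee_addgt0Pr => e e0; rewrite -cE -EFinD.
  apply: (power_ratio_lsc xg gpos).
  near=> n; have [_ _ xc] := Dx n; apply: le_trans xc _.
  rewrite lee_fin lerD2l ltW//.
  by near: n; exact: (near_infty_natSinv_lt (PosNum e0)).
by move/le_trans; apply; apply: ereal_inf_lbound; exists h.
Unshelve. all: by end_near. Qed.

End power_ratio.

(** * From minimizers to numeraires *)

Section first_order_condition.
Context d (T : measurableType d) (R : realType) (P : probability T R).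
Implicit Types (f g h : L0 P) (x : nat -> L0 P).
Variables (K : set (L0 P)) (a g : L0 P) (k : nat).
Hypotheses (K0 : K `<=` L0_nneg P) (K_convex : L0_convex K).
Hypotheses (a_pos : L0_pos P a) (k_gt0 : (0 < k)%N).
Hypotheses (Kg : K g) (g_pos : L0_pos P g).
Hypothesis g_fin : (power_ratio k a g <= 1)%E.
Hypothesis g_min : forall h, K h -> L0_pos P h ->
  (power_ratio k a g <= power_ratio k a h)%E.

Let q w : R := (`|a w| / `|g w|) ^+ k.
Let q0 w : 0 <= q w. Proof. by rewrite exprn_ge0// divr_ge0. Qed.
Let mq : measurable_fun setT q. Proof. by rewrite /q; meas. Qed.
Let p := fine (power_ratio k a g).
Let pE : mean P q = p%:E.
Proof. by rewrite fineK// (fin_num_mean _ _ g_fin). Qed.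

(** Up to the factor -k, the term carrying h / g in the t-derivative of (a / ((1 - t) g + t h))^k.
    As t tends to 0 it tends to q h / g. *)
Let weight (t : R) h w : R :=
  q w * ((1 - t + t * (`|h w| / `|g w|))^-1 ^+ k.+1 * (`|h w| / `|g w|)).

Let mweight t h : measurable_fun setT (weight t h).
Proof. by rewrite /weight; apply: measurable_funM => //; meas. Qed.

Let weight_ge0 t h w : 0 < t < 1 -> 0 <= weight t h w.
Proof.
move=> /andP[t0 t1]; rewrite mulr_ge0// mulr_ge0 ?divr_ge0// exprn_ge0//.
by rewrite invr_ge0 addr_ge0 ?subr_ge0 ?mulr_ge0 ?divr_ge0// ltW.
Qed.

(** Minimality gives p <= E[(a / f)^k] at the step f = (1 - t) g + t h, while [inverse_tangent_le],
    weighted by [q], bounds E[(a / f)^k] plus k t times the mean weight. Cancelling the finite p and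
    dividing by k t leaves the claim. *)
Lemma mean_weight_le h (t : R) : 0 < t < 1 -> K h ->
  (mean P (weight t h) <= ((1 - t)^-1 ^+ k.+1 * p)%:E)%E.
Proof.
move=> t01 Kh; have /andP[t0 t1] := t01.
have h0 := K0 Kh.
pose f : L0 P := (1 - t) *: g + t *: h.
have fE : \forall w \ae P, f w = (1 - t) * g w + t * h w by exact: L0_lincombE.
have Kf : K f by apply: K_convex => //; rewrite !ltW.
have f0 : L0_pos P f.
  apply: filterS3 fE g_pos h0 => w -> gw hw.
  by rewrite ltr_pwDl ?mulr_gt0 ?subr_gt0// mulr_ge0// ltW.
have kt0 : 0 < k%:R * t by rewrite mulr_gt0// ltr0n.
have := g_min Kf f0; rewrite {1}/power_ratio -/(mean P q) pE => pf.
have Z0 : 0 <= (1 - t)^-1 ^+ k.+1 by rewrite exprn_ge0// invr_ge0 subr_ge0 ltW.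
suff : (power_ratio k a f + (k%:R * t)%:E * mean P (weight t h) <=
    p%:E + (k%:R * t)%:E * ((1 - t)^-1 ^+ k.+1 * p)%:E)%E.
  move=> /(le_trans (leeD2r _ pf)); rewrite leeD2lE//.
  by rewrite lee_pmul2l// ?lte_fin.
rewrite -EFinM -EFinD (_ : p + _ = (1 + k%:R * t * (1 - t)^-1 ^+ k.+1) * p); last by ring.
rewrite [leRHS]EFinM -pE.
rewrite -meanZ//; [|by move=> w; exact: weight_ge0|exact: ltW].
rewrite -(meanZ P mq q0); last by rewrite addr_ge0// mulr_ge0// ltW.
have mf : measurable_fun setT (fun w => (`|a w| / `|f w|) ^+ k) by meas.
have mw : measurable_fun setT (fun w => k%:R * t * weight t h w).
  by apply: measurable_funM.
have f00 w : 0 <= (`|a w| / `|f w|) ^+ k by rewrite exprn_ge0// divr_ge0.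
have w00 w : 0 <= k%:R * t * weight t h w.
  by apply: mulr_ge0; [exact: ltW|exact: weight_ge0].
rewrite -meanD//.
apply: ae_le_mean => //.
- exact: measurable_funD.
- by apply: measurable_funM.
- by move=> w; apply: addr_ge0.
- by move=> w; rewrite mulr_ge0// addr_ge0// mulr_ge0// ltW.
apply: filterS3 fE g_pos h0 => w -> gw hw.
have r0 : 0 <= h w / g w by rewrite divr_ge0// ltW.
have fw : 0 < (1 - t) * g w + t * h w.
  by rewrite ltr_pwDl ?mulr_gt0 ?subr_gt0// mulr_ge0// ltW.
rewrite /weight /q (gtr0_norm gw) (ger0_norm hw) (gtr0_norm fw).
have -> : `|a w| / ((1 - t) * g w + t * h w) =
    `|a w| / g w * (1 - t + t * (h w / g w))^-1.
  rewrite (_ : (1 - t) * g w + t * h w = g w * (1 - t + t * (h w / g w))).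
    by rewrite invfM [LHS]mulrA.
  by field; rewrite lt0r_neq0.
rewrite exprMn [leRHS]mulrC.
set X := _ ^+ k; set A := (_^-1 ^+ k); set B := (_ * (h w / g w)).
rewrite (_ : X * A + _ = X * (A + k%:R * t * B)); last by ring.
apply: ler_wpM2l; first by rewrite exprn_ge0// divr_ge0// ltW.
exact: inverse_tangent_le.
Qed.

Lemma mean_ratio_le h : K h ->
  (mean P (fun w => q w * (`|h w| / `|g w|))%R <= p%:E)%E.
Proof.
move=> Kh; apply/lee_addgt0Pr => e e0; rewrite -EFinD.
(* [n.+2] keeps [t n] strictly below 1 already at n = 0. *)
pose t (n : nat) : R := n.+2%:R^-1.
have t01 n : 0 < t n < 1 by rewrite invr_gt0 ltr0n/= invf_lt1// ltr1n.
have tcvg : t n @[n --> \oo] --> (0 : R).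
  apply/cvgrPdist_lt => e' e'0; near=> n.
  rewrite sub0r normrN gtr0_norm; last by have /andP[] := t01 n.
  apply: (@le_lt_trans _ _ n.+1%:R^-1).
    by rewrite /t lef_pV2 ?posrE// ler_nat.
  by near: n; exact: (near_infty_natSinv_lt (PosNum e'0)).
have t1cvg : 1 - t n @[n --> \oo] --> (1 : R).
  by rewrite -[X in _ --> X]subr0; apply: cvgB => //; exact: cvg_cst.
have expcvg (u_ : nat -> R) (l : R) m : u_ n @[n --> \oo] --> l ->
    u_ n ^+ m @[n --> \oo] --> l ^+ m.
  move=> ul; exact: (@cvg_comp _ _ _ u_ (fun z : R => z ^+ m) _ _ _ ul
    (@exprn_continuous _ m _)).
apply: (@mean_fatou _ _ _ _ (fun n => weight (t n) h)) => //.
- by move=> n w; exact: weight_ge0.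
- by apply: measurable_funM => //; meas.
- by move=> w; rewrite mulr_ge0// divr_ge0.
- apply: aeW => w; apply: cvgM; first exact: cvg_cst.
  rewrite -[X in _ --> X]mul1r; apply: cvgM; last exact: cvg_cst.
  rewrite -[X in _ --> X](expr1n _ k.+1); apply: (expcvg (fun n => _)).
  rewrite -[X in _ --> X]invr1.
  apply: cvgV; first exact: oner_neq0.
  rewrite -[X in _ --> X]addr0 -[in X in _ --> X](mul0r (`|h w| / `|g w|)).
  exact: cvgD t1cvg (cvgM tcvg (cvg_cst _)).
have Zcvg : (1 - t n)^-1 ^+ k.+1 * p @[n --> \oo] --> p.
  rewrite -[X in _ --> X]mul1r; apply: cvgM; last exact: cvg_cst.
  rewrite -[X in _ --> X](expr1n _ k.+1); apply: (expcvg (fun n => _)).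
  rewrite -[X in _ --> X]invr1.
  by apply: cvgV; first exact: oner_neq0.
have pe : p < p + e by rewrite ltrDl.
apply: filterS (cvgr_lt _ Zcvg _ pe) => n Zn.
by apply: le_trans (mean_weight_le (t01 n) Kh) _; rewrite lee_fin ltW.
Unshelve. all: by end_near. Qed.

Lemma power_ratio_minimizer_numeraire : numeraire K g.
Proof.
have qpos : \forall w \ae P, 0 < q w.
  apply: filterS2 a_pos g_pos => w aw gw.
  by rewrite /q exprn_gt0// divr_gt0// normr_gt0 lt0r_neq0.
have p0 : 0 < p.
  rewrite lt_neqAle -lee_fin -pE mean_ge0// andbT; apply/eqP => p0.
  have qz : \forall w \ae P, q w = 0 by apply: mean_eq0; rewrite ?pE -?p0.
  have : (mean P (fun=> 1%R) <= mean P (fun=> 0%R))%E.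
    by apply: ae_le_mean => //; apply: filterS2 qz qpos => w ->; rewrite ltxx.
  by rewrite !mean_cst lee_fin ler10.
have pq0 w : 0 <= p^-1 * q w by rewrite mulr_ge0// invr_ge0 ltW.
have mpq : measurable_fun setT (fun w => p^-1 * q w) by apply: measurable_funM.
have mean1 : mean P (fun w => p^-1 * q w) = 1%E.
  by rewrite meanZ ?invr_ge0 ?ltW// pE -EFinM mulVf// lt0r_neq0.
have [|Q [QP PQ QE]] := density_probability mpq pq0 mean1.
  by apply: filterS qpos => w qw; rewrite mulr_gt0// invr_gt0.
split => //; exists Q; split => // h Kh.
have mr : measurable_fun setT (fun w => `|h w| / `|g w|) by meas.
have r0 w : 0 <= `|h w| / `|g w| by rewrite divr_ge0.
rewrite expectation_ratioE//; last exact: K0.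
rewrite QE//.
rewrite (_ : (fun w => _) = (fun w => p^-1 * (q w * (`|h w| / `|g w|)))); last first.
  by apply/funext => w; ring.
rewrite meanZ; [|by apply: measurable_funM|by move=> w; rewrite mulr_ge0|
  by rewrite invr_ge0 ltW].
apply: (@le_trans _ _ (p^-1%:E * p%:E)%E).
  by rewrite lee_pmul2l ?lte_fin ?invr_gt0//; exact: mean_ratio_le.
by rewrite -EFinM mulVf// lt0r_neq0.
Qed.

End first_order_condition.

(** * Density *)

Section closure_facts.
Context d (T : measurableType d) (R : realType) (P : probability T R).
Implicit Types (f g h : L0 P) (C : set (L0 P)) (x : nat -> L0 P).

Lemma closure_L0_nneg C : C `<=` L0_nneg P -> closure C `<=` L0_nneg P.
Proof.
move=> C0 g /closure_ae_cvgP[x Cx xg].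
have x0 : \forall w \ae P, forall n, 0 <= x n w.
  by apply: ae_foralln => n; exact: C0.
apply: filterS2 xg x0 => w xw xw0.
by apply: (cvgr_to_ge xw); apply: nearW.
Qed.

Lemma ae_closed_closure C : ae_closed (closure C).
Proof.
move=> x g Cx xg; have := @closed_closure _ C; apply.
by apply/closure_ae_cvgP; exists x.
Qed.

Lemma closure_tight C : L0_uniformly_tight C -> L0_uniformly_tight (closure C).
Proof.
move=> tC e e0; have [l l0 lC] := tC _ e0; exists l => // g.
move=> /closure_ae_cvgP[x Cx xg].
apply: (measure_eventually_le (A_ := fun n => [set w | l < x n w])).
- by move=> n; exact: measurable_lt_L0.
- exact: measurable_lt_L0.
- by apply: filterS xg => w xw /= lg; exact: (cvgr_gt _ xw).
- by apply: nearW => n; exact: lC.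
Qed.

Lemma closure_L0_convex C : L0_convex C -> L0_convex (closure C).
Proof.
move=> cC f g t t01 /closure_ae_cvgP[x Cx xf] /closure_ae_cvgP[y Cy yg].
apply/closure_ae_cvgP; exists (fun n => (1 - t) *: x n + t *: y n).
  by move=> n; exact: cC.
have xyE : \forall w \ae P, forall n,
    ((1 - t) *: x n + t *: y n : L0 P) w = (1 - t) * x n w + t * y n w.
  by apply: ae_foralln => n; exact: L0_lincombE.
have fgE : \forall w \ae P, ((1 - t) *: f + t *: g : L0 P) w = (1 - t) * f w + t * g w.
  exact: L0_lincombE.
have xyfg : \forall w \ae P, x ^~ w @ \oo --> f w /\ y ^~ w @ \oo --> g w.
  by apply: filterS2 xf yg.
apply: filterS3 xyE fgE xyfg => w xyw -> [xw yw].
under eq_fun do rewrite xyw.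
exact: cvgD (cvgM (cvg_cst _) xw) (cvgM (cvg_cst _) yw).
Qed.

Lemma convex_set_L0_convex C :
  convex_set (C : set (convex_lmodType (L0 P))) -> L0_convex C.
Proof.
move=> cC f g t /andP[t0 t1] Cf Cg.
have s0 : 0 <= 1 - t by rewrite subr_ge0.
have s1 : 1 - t <= 1 by rewrite gerBl.
have := cC f g (Itv01 s0 s1) (mem_set Cf) (mem_set Cg).
rewrite inE; congr C.
by congr (_ + _ *: _); exact: subKr.
Qed.

Lemma bounded_tight C : L0_bounded C -> L0_uniformly_tight C.
Proof.
move=> bC e e0.
have e0' : (0 < e%:E)%E by rewrite lte_fin.
have : \forall l \near +oo,
    (ereal_sup [set P [set w | (l < L0_fun f w)%R] | f in C] < e%:E)%E.
  have /fine_cvgP[fC /cvgr_lt/(_ _ e0) ltC] := bC.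
  by near=> l; rewrite -[X in (X < _)%E]fineK ?lte_fin; near: l.
move=> supC.
near (pinfty_nbhs R) => l; exists l => [|f Cf].
  by near: l; exact: nbhs_pinfty_ge.
have /ltW lC : (ereal_sup [set P [set w | (l < L0_fun f w)%R] | f in C] < e%:E)%E.
  by near: l.
apply: le_trans lC.
by apply: ereal_sup_ubound; exists f.
Unshelve. all: by end_near. Qed.

Lemma L0_le_refl f : L0_le f f.
Proof. exact: aeW. Qed.

Lemma L0_le_trans g f h : L0_le f g -> L0_le g h -> L0_le f h.
Proof. by move=> fg gh; apply: filterS2 fg gh => w; exact: le_trans. Qed.

Lemma L0_le_anti f g : L0_le f g -> L0_le g f -> f = g.
Proof.
move=> fg gf; apply/L0_eqP; apply: filterS2 fg gf => w fgw gfw.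
by apply/eqP; rewrite eq_le fgw.
Qed.

End closure_facts.

(** * Existence and stability of maximal elements *)

Section maximal_elements.
Context d (T : measurableType d) (R : realType) (P : probability T R).
Implicit Types (f g h : L0 P) (C K : set (L0 P)) (x : nat -> L0 P).

(** The penalty takes the place of Zorn's lemma: it is strictly decreasing in its argument, so a
    minimizer among the elements above [h] is maximal. The sets [D n] are constant here. *)
Lemma maximal_dominating K h : L0_uniformly_tight K -> K `<=` L0_nneg P ->
  L0_convex K -> ae_closed K -> K h -> exists2 g, maximal K g & L0_le h g.
Proof.
move=> tK K0 cK clK Kh.
pose D (n : nat) := [set g | K g /\ L0_le h g].
have [//|//|n f []//|n|m n _ f //|n f g [Kf hf] [Kg hg]|x [g [Dx g0 xg xmin]]] :=
    @penalty_minimizing_cvg _ _ _ P K D.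
- by exists h; split => //; exact: L0_le_refl.
- split.
    have := cK f g 2^-1; rewrite (_ : 1 - 2^-1 = 2^-1 :> R); last by lra.
    by apply => //; lra.
  by apply: filterS3 hf hg (midE f g) => w fw gw ->; lra.
have Kg : K g by apply: (clK _ _ _ xg) => n; have [] := Dx n.
have hg : L0_le h g.
  have hx : \forall w \ae P, forall n, h w <= x n w.
    by apply: ae_foralln => n; have [] := Dx n.
  apply: filterS2 hx xg => w hxw xw.
  by apply: (cvgr_to_ge xw); exact: nearW.
exists g => //; split => // f Kf gf; apply/esym/L0_eqP.
have pen : penalty g <= penalty f.
  apply: (cvgr_to_le (F := \oo) (f := fun n => penalty (x n) - 4^-1 ^+ n)).
    rewrite -[X in _ --> X]subr0; apply: cvgB; first exact: penalty_cvg.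
    by apply: cvg_expr; rewrite ger0_norm//; lra.
  apply: nearW => n; rewrite lerBlDr.
  have [m] := xmin n; apply; split => //; exact: L0_le_trans gf.
have u0 f' w : 0 <= (1 + `|L0_fun f' w|)^-1 :> R by rewrite invr_ge0 addr_ge0.
have eq_inv : \forall w \ae P, (1 + `|f w|)^-1 = (1 + `|g w|)^-1.
  apply: (@mean_le_ae_eq _ _ _ P).
  - by meas.
  - by meas.
  - exact: u0.
  - exact: u0.
  - apply: filterS3 gf g0 (K0 _ Kf) => w gfw gw fw.
    by rewrite lef_pV2 ?posrE ?ltr_wpDr// lerD2l !ger0_norm.
  - by rewrite -!penaltyE lee_fin.
  - by rewrite -penaltyE ltry.
apply: filterS3 g0 (K0 _ Kf) eq_inv => w gw fw /invr_inj/addrI.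
by rewrite !ger0_norm.
Qed.

(** An [h] of the closure above [f] lies below a maximal [g] of the closure, which [max_closed] puts
    in [C]; maximality of [f] in [C] then gives f <= h <= g = f. *)
Lemma maximal_closure C : L0_uniformly_tight C -> C `<=` L0_nneg P ->
  L0_convex C -> max_closed C -> maximal C `<=` maximal (closure C).
Proof.
move=> tC C0 cC mC f [Cf fmax]; split; first exact: subset_closure.
move=> h Kh fh.
have [g gmax hg] := maximal_dominating (closure_tight tC)
  (closure_L0_nneg C0) (closure_L0_convex cC) (@ae_closed_closure _ _ _ _ C) Kh.
apply: L0_le_anti => //.
by rewrite [f](fmax g (mC _ gmax) (L0_le_trans fh hg)).
Qed.

(** Only the part of [g] below [f] is charged; any excess is left to maximality. The weight 1 / (1 +
    |f|) keeps the mean finite on [L0_nneg] and matches the penalty in [penalty_le_shortfall]. *)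
Definition shortfall f g : \bar R :=
  mean P (fun w => Num.max 0 (f w - g w) / (1 + `|f w|)).

Let short f g w : R := Num.max 0 (f w - g w) / (1 + `|f w|).
Let short_ge0 f g w : 0 <= short f g w.
Proof. by rewrite divr_ge0 ?addr_ge0// le_max lexx. Qed.
Let mshort f g : measurable_fun setT (short f g).
Proof. by rewrite /short; meas. Qed.

Lemma shortfall_mid f g h (c : R) :
  (shortfall f g <= c%:E -> shortfall f h <= c%:E ->
   shortfall f (mid g h) <= c%:E)%E.
Proof.
move=> gc hc.
apply: (@le_trans _ _ (2^-1%:E * shortfall f g + 2^-1%:E * shortfall f h)%E).
  have half0 : 0 <= 2^-1 :> R by [].
  have p2 g' w : 0 <= 2^-1 * short f g' w by rewrite mulr_ge0.
  have m2 g' : measurable_fun setT (fun w => 2^-1 * short f g' w).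
    by apply: measurable_funM => //; exact: mshort.
  rewrite -(meanZ P (mshort f g) (short_ge0 f g) half0).
  rewrite -(meanZ P (mshort f h) (short_ge0 f h) half0).
  rewrite -meanD; [|exact: m2|exact: m2|exact: p2|exact: p2].
  apply: ae_le_mean.
  - exact: mshort.
  - by apply: measurable_funD; exact: m2.
  - exact: short_ge0.
  - by move=> w; apply: addr_ge0; exact: p2.
  apply: filterS (midE g h) => w; rewrite /short => ->.
  rewrite !mulrA -mulrDl ler_wpM2r ?invr_ge0 ?addr_ge0//.
  rewrite ge_max; apply/andP; split.
    by rewrite addr_ge0// mulr_ge0// le_max lexx.
  have : f w - g w <= Num.max 0 (f w - g w) by rewrite le_max lexx orbT.
  have : f w - h w <= Num.max 0 (f w - h w) by rewrite le_max lexx orbT.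
  lra.
rewrite (_ : c%:E = (2^-1%:E * c%:E + 2^-1%:E * c%:E)%E); last first.
  by rewrite -!EFinM -EFinD; congr EFin; lra.
by apply: leeD; apply: lee_pmul => //; [exact: mean_ge0 (short_ge0 _ _)|
  exact: mean_ge0 (short_ge0 _ _)].
Qed.

(** With m the positive part of f - g one has 1 + f <= (1 + m) (1 + g), that is 1 / (1 + g) <= 1 /
    (1 + f) + m / (1 + f). *)
Lemma penalty_le_shortfall f g (c : R) : L0_nneg P f -> L0_nneg P g ->
  (shortfall f g <= c%:E)%E -> penalty g <= penalty f + c.
Proof.
move=> f0 g0 fgc.
rewrite -lee_fin EFinD; apply: le_trans (leeD2l _ fgc); rewrite !penaltyE.
have u0 f' w : 0 <= (1 + `|L0_fun f' w|)^-1 :> R by rewrite invr_ge0 addr_ge0.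
rewrite -meanD; [|by meas|exact: mshort|exact: u0|exact: short_ge0].
apply: ae_le_mean.
- by meas.
- by apply: measurable_funD; [meas|exact: mshort].
- exact: u0.
- by move=> w; apply: addr_ge0; [exact: u0|exact: short_ge0].
apply: filterS2 f0 g0 => w fw gw; rewrite /short (ger0_norm fw) (ger0_norm gw).
have f1 : 0 < 1 + f w by lra.
have g1 : 0 < 1 + g w by lra.
set m := Num.max _ _.
have m0 : 0 <= m by rewrite le_max lexx.
have fgm : f w - g w <= m by rewrite le_max lexx orbT.
rewrite (_ : (1 + f w)^-1 + m / (1 + f w) = (1 + m) / (1 + f w)); last first.
  by rewrite mulrDl mul1r.
rewrite ler_pdivlMr// mulrC ler_pdivrMr//.
have : 0 <= m * g w by rewrite mulr_ge0.
lra.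
Qed.

(* Maximality makes [f] the only cluster point of elements with small
   shortfall, so [f] itself nearly minimizes the penalty among them. *)
Lemma maximal_dist K f : L0_uniformly_tight K -> K `<=` L0_nneg P ->
  L0_convex K -> ae_closed K -> maximal K f -> forall e, 0 < e ->
  exists n : nat, forall g, K g -> (shortfall f g <= (n.+1%:R^-1)%:E)%E ->
    L0_dist f g < e.
Proof.
move=> tK K0 cK clK [Kf fmax] e e0.
have f0 := K0 _ Kf.
have K_mid g h : K g -> K h -> K (mid g h).
  move=> Kg Kh; have := cK g h 2^-1; rewrite (_ : 1 - 2^-1 = 2^-1 :> R); last by lra.
  by apply => //; lra.
pose D (n : nat) := [set g | K g /\ (shortfall f g <= (n.+1%:R^-1)%:E)%E].
have Dle m n : (m <= n)%N -> D n `<=` D m.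
  move=> mn g [Kg gn]; split => //; apply: le_trans gn _.
  by rewrite lee_fin lef_pV2 ?posrE// ler_nat ltnS.
have Df n : D n f.
  split => //; rewrite /shortfall.
  under [X in mean _ X]eq_fun do rewrite subrr maxxx mul0r.
  by rewrite mean_cst lee_fin.
have Dmid n g h : D n g -> D n h -> D n (mid g h).
  by move=> [Kg gc] [Kh hc]; split; [exact: K_mid|exact: shortfall_mid].
have [//|//|n g []//|n|//|//|x [g [Dx g0 xg xmin]]] :=
    @penalty_minimizing_cvg _ _ _ P K D.
  by exists f; exact: Df.
have Kg : K g by apply: (clK _ _ _ xg) => n; have [] := Dx n.
(* The shortfalls of [x n] tend to 0, so the limit dominates [f] and maximality applies. *)
have fg : f = g.
  apply: fmax => //.
  have : (shortfall f g <= 0)%E.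
    apply/lee_addgt0Pr => c c0; rewrite add0e.
    apply: (@mean_fatou _ _ _ _ (fun n => short f (x n))).
    - by move=> n; exact: mshort.
    - by move=> n w; exact: short_ge0.
    - exact: mshort.
    - exact: short_ge0.
    - apply: filterS xg => w xw.
      have fxw : f w - x n w @[n --> \oo] --> f w - g w.
        by apply: cvgB => //; exact: cvg_cst.
      rewrite /short; apply: cvgM; last exact: cvg_cst.
      rewrite maxr_absE; under eq_fun do rewrite maxr_absE.
      apply: cvgM; last exact: cvg_cst.
      apply: cvgD; first by apply: cvgD => //; exact: cvg_cst.
      by apply: cvg_norm; apply: cvgB => //; exact: cvg_cst.
    near=> n; have [_ xc] := Dx n; apply: le_trans xc _.
    rewrite lee_fin ltW//.
    by near: n; exact: (near_infty_natSinv_lt (PosNum c0)).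
  move=> /(mean_eq0 (mshort f g) (short_ge0 f g)); apply: filterS => w /eqP.
  rewrite mulf_eq0 invr_eq0 [X in _ || X]gt_eqF ?ltr_wpDr// orbF.
  by rewrite eq_maxl subr_le0.
have [c c0 cdist] := penalty_gap_dist f0 (fun e e0 =>
  let: ex_intro2 l l0 lK := tK e e0 in
  ex_intro2 _ _ l l0 (fun h (hf : [set f] h) => lK h (eq_ind_r K Kf hf))) e0.
have c80 : 0 < c / 8 by rewrite divr_gt0.
(* The midpoint of [f] and [h] will have penalty above [penalty f - c / 8] by these two bounds,
   while the average of the two penalties is below [penalty f + c / 8] once the shortfall is below c
   / 4. A quarter of the gap is then below c / 4. *)
have [n0 pen small] : exists2 n, penalty f - c / 16 < penalty (x n) &
    4^-1 ^+ n < c / 16.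
  have c16 : penalty f - c / 16 < penalty g by rewrite fg ltrBlDr ltrDl; lra.
  have c160 : 0 < c / 16 by lra.
  have expr0 : (4^-1 : R) ^+ n @[n --> \oo] --> (0 : R).
    by apply: cvg_expr; rewrite ger0_norm//; lra.
  near \oo => n; exists n; near: n.
    exact: (cvgr_gt _ (penalty_cvg xg)).
  exact: (cvgr_lt _ expr0).
have [m xm] := xmin n0.
have [n mn nc] : exists2 n, (m <= n)%N & n.+1%:R^-1 < c / 4.
  have c40 : 0 < c / 4 by lra.
  near \oo => n; exists n; near: n; first exact: nbhs_infty_ge.
  exact: (near_infty_natSinv_lt (PosNum c40)).
exists n => h Kh fh.
apply: cdist; first exact: K0.
have := penalty_mid f0 (K0 _ Kh).
have := penalty_le_shortfall f0 (K0 _ Kh) fh.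
have := xm _ (Dmid _ _ _ (Df m) (Dle _ _ mn _ (conj Kh fh))).
move: pen small nc; move: (4^-1 ^+ n0) (n.+1%:R^-1) => y z; lra.
Unshelve. all: by end_near. Qed.

End maximal_elements.

(** Let r be the ratio on the right. If r <= 1 then (1 - e) f <= g, so f - g <= e f. If r > 1 and g
    < f then f - g <= (r - 1) g + e f <= (r - 1) f + e f, and Bernoulli's inequality bounds r - 1 by
    r^k / k. *)
Lemma relative_shortfall_le (R : realFieldType) (k : nat) (f g p e : R) :
  0 <= f -> 0 < g -> 0 < p -> 0 < e < 1 -> (0 < k)%N ->
  Num.max 0 (f - g) / (1 + f) <=
  e + k%:R^-1 * (((1 - e) * f + e * p) / g) ^+ k.
Proof.
move=> f0 g0 p0 /andP[e0 e1] k0.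
set r := _ / g.
have k0' : 0 < k%:R :> R by rewrite ltr0n.
have ep0 : 0 < e * p by rewrite mulr_gt0.
have ef0 : 0 <= (1 - e) * f by rewrite mulr_ge0// subr_ge0 ltW.
have r0 : 0 < r by rewrite divr_gt0//; lra.
have rk0 : 0 <= k%:R^-1 * r ^+ k by rewrite mulr_ge0// ?invr_ge0 ?exprn_ge0// ltW.
have f1 : 0 < 1 + f by lra.
rewrite ler_pdivrMr// ge_max; apply/andP; split.
  by rewrite mulr_ge0// ?addr_ge0// ltW.
have fr : (1 - e) * f <= r * g by rewrite /r divfK ?lt0r_neq0//; lra.
set s := k%:R^-1 * r ^+ k in rk0 *.
have sf : 0 <= s * f by rewrite mulr_ge0.
have [r1|r1] := leP r 1.
  have : r * g <= g by rewrite ler_piMl// ltW.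
  lra.
have bernoulli : r - 1 <= s.
  rewrite /s mulrC ler_pdivlMr// mulrC.
  elim: (k) => [|n ih]; first by rewrite mul0r expr0.
  rewrite exprS -[n.+1]addn1 natrD mulrDl mul1r.
  have : 1 <= r ^+ n by rewrite exprn_ege1// ltW.
  have : 0 <= (r - 1) * (r ^+ n - 1).
    by rewrite mulr_ge0// subr_ge0 ?exprn_ege1// ltW.
  move: ih; move: (r ^+ n) => X; lra.
have ef : 0 <= e * f by rewrite mulr_ge0// ltW.
have [fg|gf] := leP f g; first by lra.
have : (r - 1) * g <= (r - 1) * f by rewrite ler_wpM2l ?subr_ge0// ltW.
have : (r - 1) * f <= s * f by rewrite ler_wpM2r.
lra.
Qed.

Theorem theorem3p1 (d : measure_display) (T : measurableType d) (R : realType)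
    (P : probability T R) (C : set (L0 P))
    (C_nneg : C `<=` L0_nneg P)
    (C_convex : convex_set (C : set (convex_lmodType (L0 P))))
    (C_max_closed : max_closed C)
    (C_bounded : L0_bounded C)
    (C_pos : C `&` L0_pos P !=set0) :
  dense_in (numeraire C) (maximal C).
Proof.
split; first exact: numeraire_maximal.
have C_tight := bounded_tight C_bounded.
have cC := convex_set_L0_convex C_convex.
have K_tight := closure_tight C_tight.
have K0 := closure_L0_nneg C_nneg.
have cK := closure_L0_convex cC.
have clK := @ae_closed_closure _ _ _ P C.
have CK := @subset_closure _ C.
suff : forall f : L0 P, maximal C f -> closure (numeraire C) f by [].
move=> f Cf; apply/closure_L0P => e e0.
have f0 := C_nneg _ (proj1 Cf).
have [N fN] := maximal_dist K_tight K0 cK clK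
  (maximal_closure C_tight C_nneg cC C_max_closed Cf) e0.
have [p [Cp p0]] := C_pos.
(* [relative_shortfall_le] with e = 1 / k and E[(a / g)^k] <= 1 gives a shortfall of at most 2 / k =
   1 / (N + 1); the factor 2 also ensures 1 / k < 1. *)
pose k := (N.+1 * 2)%N.
have k0 : (0 < k)%N by rewrite muln_gt0.
have k0' : 0 < k%:R^-1 :> R by rewrite invr_gt0 ltr0n.
have k1' : k%:R^-1 < 1 :> R by rewrite invf_lt1 ?ltr0n// ltr1n; lia.
pose a : L0 P := (1 - k%:R^-1) *: f + k%:R^-1 *: p.
have aE : \forall w \ae P, a w = (1 - k%:R^-1) * f w + k%:R^-1 * p w.
  exact: L0_lincombE.
have Ka : closure C a.
  by apply/CK/cC => //; [rewrite !ltW|exact: (proj1 Cf)].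
have a_pos : L0_pos P a.
  apply: filterS3 aE f0 p0 => w -> fw pw.
  by rewrite ltr_wpDl ?mulr_gt0// mulr_ge0// subr_ge0 ltW.
have [g [Kg g_pos g_min]] := power_ratio_minimizer K_tight K0 cK clK Ka a_pos k0.
have g1 : (power_ratio k a g <= 1)%E.
  by rewrite -(power_ratio_self k a_pos); exact: g_min.
have gnum := power_ratio_minimizer_numeraire K0 cK a_pos k0 Kg g_pos g1 g_min.
have Cg : C g by apply: C_max_closed; exact: numeraire_maximal.
exists g.
  split => //; have [_ _ [Q [QP PQ gQ]]] := gnum.
  by exists Q; split => // h Ch; apply: gQ; exact: CK.
apply: fN => //.
apply: (@le_trans _ _ (k%:R^-1%:E + k%:R^-1%:E * power_ratio k a g)%E).
  have mr : measurable_fun setT (fun w => (`|a w| / `|g w|) ^+ k) by meas.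
  have r0 w : 0 <= (`|a w| / `|g w|) ^+ k by rewrite exprn_ge0// divr_ge0.
  rewrite -(meanZ P mr r0 (ltW k0')) -(mean_cst P k%:R^-1).
  have kr0 w : 0 <= k%:R^-1 * (`|a w| / `|g w|) ^+ k by rewrite mulr_ge0// ltW.
  rewrite -meanD; [|by meas|by apply: measurable_funM|
    by move=> w; rewrite ltW|exact: kr0].
  apply: ae_le_mean.
  - by meas.
  - by apply: measurable_funD => //; apply: measurable_funM.
  - by move=> w; rewrite divr_ge0 ?addr_ge0// le_max lexx.
  - by move=> w; apply: addr_ge0; [exact: ltW|exact: kr0].
  have fp : \forall w \ae P, 0 <= f w /\ 0 < p w by apply: filterS2 f0 p0.
  have ag : \forall w \ae P, [/\ a w = (1 - k%:R^-1) * f w + k%:R^-1 * p w,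
      0 < a w & 0 < g w].
    by apply: filterS3 aE a_pos g_pos.
  apply: filterS2 fp ag => w [fw pw] [aw aw0 gw].
  rewrite (ger0_norm fw) (gtr0_norm aw0) (gtr0_norm gw) aw.
  by apply: relative_shortfall_le => //; rewrite k0'.
apply: (@le_trans _ _ (k%:R^-1%:E + k%:R^-1%:E * 1)%E).
  by rewrite leeD2l// lee_pmul2l// lte_fin.
rewrite mule1 -EFinD lee_fin /k natrM invfM; move: (N.+1%:R^-1) => z; lra.
Qed.
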